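(* Let $F$ be a nonabelian finitely generated free profinite group, and let $H$ be a closed subgroup of infinite index in $F$. Then there exists a closed subgroup $L$ of $F$ with $H\le L\le F$ such that $L$ is a free profinite group of rank $\aleph_0$.
   Context: A subset $X$ of a profinite group $G$ generates $G$ if the abstract subgroup generated by $X$ is dense in $G$; $X$ converges to $1$ if every open subgroup of $G$ contains all but finitely many elements of $X$. A profinite group $F$ is a free profinite group if it is generated by a subset $X$ converging to $1$ (a profinite basis) such that every function $\alpha\colon X\to L$ to a finite group $L$ with $\alpha(x)\neq 1$ for only finitely many $x\in X$ extends to a continuous homomorphism $F\to L$. The rank of $F$ is $|X|$ (independent of the choice of the basis). A profinite group is finitely generated if it has a finite subset such that the abstract subgroup generated by this subset is dense in the group. *)

(* Defs.v *)
From HB Require Import structures.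
From mathcomp Require Import all_boot all_fingroup.
From mathcomp Require Import all_classical topology.

Set Implicit Arguments.
Unset Strict Implicit.
Unset Printing Implicit Defensive.

Local Open Scope classical_set_scope.
Local Open Scope card_scope.
Local Open Scope group_scope.

HB.structure Definition PreTopologicalGroup :=
  {G of monoid.Group G & Topological G}.

HB.mixin Record PreTopologicalGroup_isTopologicalGroup G
    & PreTopologicalGroup G := {
  mulg_continuous : continuous (fun x : G * G => x.1 * x.2) ;
  invg_continuous : continuous (fun x : G => x^-1) ;
}.

#[short(type="topologicalGroupType")]
HB.structure Definition TopologicalGroup :=
  {G of PreTopologicalGroup G & PreTopologicalGroup_isTopologicalGroup G}.

Definition is_subgroup (G : groupType) (A : set G) : Prop :=
  group_closed [in A].

Record subgroup (G : groupType) := Subgroup {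
  subgroup_set :> set G ;
  subgroupP : is_subgroup subgroup_set }.

HB.instance Definition _ (G : topologicalType) (A : set G) :=
  SubChoice.copy (set_type A) {x : G | x \in A}.

HB.instance Definition _ (G : topologicalGroupType) (H : subgroup G) :=
  SubChoice_isSubGroup.Build G [in subgroup_set H] (set_type H) (subgroupP H).

Section SubgroupTopology.
Variables (G : topologicalGroupType) (H : subgroup G).

Let val_continuous : continuous (set_val : set_type H -> G).
Proof. exact: initial_continuous. Qed.

Let continuous_val (T : topologicalType) (f : T -> set_type H) :
  continuous (set_val \o f) -> continuous f.
Proof.
move=> /continuousP cf; apply/continuousP => _ [B oB <-].
exact: cf.
Qed.

Let mul_continuous :
  continuous (fun x : set_type H * set_type H => x.1 * x.2).
Proof.
apply: continuous_val => x.
apply: (@continuous_comp _ (G * G)%type _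
  (fun y : set_type H * set_type H => (set_val y.1, set_val y.2))
  (fun z : G * G => z.1 * z.2)); last exact: mulg_continuous.
apply: cvg_pair => /=.
- by apply: (@continuous_comp _ _ _ fst set_val);
    [exact: cvg_fst|exact: val_continuous].
- by apply: (@continuous_comp _ _ _ snd set_val);
    [exact: cvg_snd|exact: val_continuous].
Qed.

Let inv_continuous : continuous (fun x : set_type H => x^-1).
Proof.
apply: continuous_val => x.
by apply: (@continuous_comp _ _ _ set_val (fun z : G => z^-1));
  [exact: val_continuous|exact: invg_continuous].
Qed.

HB.instance Definition _ := PreTopologicalGroup_isTopologicalGroup.Build
  (set_type H) mul_continuous inv_continuous.

End SubgroupTopology.

Definition profinite (G : topologicalGroupType) : Prop :=
  [/\ compact [set: G], hausdorff_space G & totally_disconnected [set: G]].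

Definition abstract_gen (G : groupType) (X : set G) : set G :=
  smallest (@is_subgroup G) X.

Definition generates (G : topologicalGroupType) (X : set G) : Prop :=
  dense (abstract_gen X).

Definition converges_to_1 (G : topologicalGroupType) (X : set G) : Prop :=
  forall U : set G, is_subgroup U -> open U -> finite_set (X `\` U).

Definition continuous_hom (G : topologicalGroupType) (K : finGroupType)
    (f : G -> K) : Prop :=
  {morph f : x y / x * y >-> x * y} /\
  continuous (f : G -> discrete_topology K).

(* [alpha] is total, but only its values on [X] matter. *)
Definition profinite_basis (G : topologicalGroupType) (X : set G) : Prop :=
  [/\ generates X,
      converges_to_1 X &
      forall (K : finGroupType) (alpha : G -> K),
        finite_set [set x | X x /\ alpha x <> 1] ->
        exists phi : G -> K,
          continuous_hom phi /\ (forall x, X x -> phi x = alpha x)].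

Definition free_profinite (G : topologicalGroupType) : Prop :=
  profinite G /\ exists X : set G, profinite_basis X.

(* The rank is a cardinal, given by a set [A] of that cardinality. *)
Definition free_profinite_of_rank (G : topologicalGroupType)
    (T : Type) (A : set T) : Prop :=
  profinite G /\ exists X : set G, profinite_basis X /\ X #= A.

Definition finitely_generated (G : topologicalGroupType) : Prop :=
  exists X : set G, finite_set X /\ generates X.

Definition nonabelian (G : groupType) : Prop :=
  exists x y : G, x * y <> y * x.

Definition left_cosets (G : groupType) (H : set G) : set (set G) :=
  range (fun g : G => [set g * h | h in H]).

Definition infinite_index (G : groupType) (H : set G) : Prop :=
  infinite_set (left_cosets H).

(* Main.v *)
Require Import Defs.
From HB Require Import structures.
From mathcomp Require Import all_boot all_fingroup finmap zify.
From mathcomp Require Import all_classical topology.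

(** The criterion behind the proof is Iwasawa's: a closed subgroup [L] of [F] is
    free of rank aleph_0 as soon as every finite embedding problem for [L], a
    homomorphism [f : L -> A] and a surjection [p : B -> f(L)] of finite groups,
    has a solution [g : L -> B] that is itself surjective ([iwasawa]; countably
    many open subgroups suffice because [F] is finitely generated).  So [H] has
    to be enlarged to an [L] with this property.

    [L] is the intersection of a decreasing chain of open subgroups [U_n], each
    with a finite basis, built along with an increasing chain [P_n] of closed
    subgroups of infinite index with [H <= P_n <= U_n] ([rich_exists]).  Every
    quotient [z = y_i y_j^-1] of two elements of the basis of [U_n] is considered
    in turn: if the closed subgroup generated by [P_n] and [z] still has infinite
    index, [z] is thrown into [P_{n+1}]; otherwise that subgroup is open.  In the
    end every such [z] lies in [L] or generates an open subgroup together with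
    [L].  The inclusions between the [U_n] are strict, so by Nielsen-Schreier
    ([nielsen_schreier]) the ranks of the [U_n] tend to infinity.

    Such an [L] solves its embedding problems ([rich_embedding]).  Extend [f] to
    some [U = U_n] with a very large basis; many basis elements [y_0, ..., y_m]
    then have the same image in [A].  If all [z_i = y_i y_0^-1] lie in [L], a lift
    of [f] to [U] can send the [z_i] onto the kernel of [p], whence it is
    surjective already on [L].  Otherwise some [z = z_i] is not in [L], and
    [V = <L, z>] is open.  Replacing [y_i] by [z] gives another basis of [U], and
    the Schreier basis of [V] contains the basis elements of [U] that lie in [V],
    in particular [z].  Since [f z = 1], there is a lift [g] of [f] to [V] with
    [g z = 1], surjective thanks to the many other basis elements; and
    [g z = 1] forces [g(L) = g(V)].

    Everything happens inside [F]: homomorphisms from a subgroup to a finite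
    group are functions on [F] with conditions on the subgroup ([hom_on]), and
    topological generation is tested on open subgroups ([free_basis]). *)

Set Implicit Arguments.
Unset Strict Implicit.
Unset Printing Implicit Defensive.

Local Open Scope classical_set_scope.
Local Open Scope group_scope.

(** * Subgroups and open subgroups of a topological group *)

Lemma is_subgroupP (G : groupType) (A : set G) :
  is_subgroup A <->
  [/\ A 1, forall x y, A x -> A y -> A (x * y) & forall x, A x -> A x^-1].
Proof.
split=> [gA|[A1 AM AV]].
  split; first by have /set_mem := gA.1.
  - by move=> x y /mem_set xA /mem_set yA; exact/set_mem/(group_closedM gA).
  - by move=> x /mem_set xA; exact/set_mem/(group_closedV gA).
split; first exact/mem_set.
by move=> x y /set_mem Ax /set_mem Ay; apply/mem_set/AM => //; apply: AV.
Qed.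

Section Group.
Variables (G : groupType).
Implicit Types A B : set G.

Lemma subgroup1 A : is_subgroup A -> A 1.
Proof. by case/is_subgroupP. Qed.

Lemma subgroupM A x y : is_subgroup A -> A x -> A y -> A (x * y).
Proof. by case/is_subgroupP => _ + _; apply. Qed.

Lemma subgroupV A x : is_subgroup A -> A x -> A x^-1.
Proof. by case/is_subgroupP => _ _; apply. Qed.

Lemma subgroupI A B : is_subgroup A -> is_subgroup B -> is_subgroup (A `&` B).
Proof.
move=> /is_subgroupP[A1 AM AV] /is_subgroupP[B1 BM BV].
apply/is_subgroupP; split => [//|x y [? ?] [? ?]|x [? ?]]; split; auto.
Qed.

Lemma subgroup_bigcap I (P : set I) (f : I -> set G) :
  (forall i, P i -> is_subgroup (f i)) -> is_subgroup (\bigcap_(i in P) f i).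
Proof.
move=> fP; apply/is_subgroupP; split.
- by move=> i /fP/subgroup1.
- by move=> x y fx fy i Pi; apply: subgroupM; [exact: fP|exact: fx|exact: fy].
- by move=> x fx i Pi; apply: subgroupV; [exact: fP|exact: fx].
Qed.

Lemma subgroup_conj A g : is_subgroup A -> is_subgroup [set x | A (g * x * g^-1)].
Proof.
move=> gA; apply/is_subgroupP; split => /=.
- by rewrite mulg1 mulgV; exact: subgroup1.
- move=> x y Ax Ay; have := subgroupM gA Ax Ay.
  by rewrite !mulgA mulgKV.
- by move=> x /(subgroupV gA); rewrite !invgM invgK mulgA.
Qed.

End Group.

Section Open.
Variable F : topologicalGroupType.
Implicit Types (A W N : set F).

Definition open_subgroup W := is_subgroup W /\ open W.

Lemma mulgl_continuous (a : F) : continuous (fun x : F => a * x).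
Proof.
move=> x; apply: (@continuous_comp _ (F * F)%type _ (fun y : F => (a, y))
  (fun z : F * F => z.1 * z.2)); last exact: mulg_continuous.
by apply: cvg_pair => /=; [exact: cvg_cst|exact: cvg_id].
Qed.

Lemma mulgr_continuous (a : F) : continuous (fun x : F => x * a).
Proof.
move=> x; apply: (@continuous_comp _ (F * F)%type _ (fun y : F => (y, a))
  (fun z : F * F => z.1 * z.2)); last exact: mulg_continuous.
by apply: cvg_pair => /=; [exact: cvg_id|exact: cvg_cst].
Qed.

Lemma open_mulgl W (a : F) : open W -> open [set x | W (a * x)].
Proof.
by move=> oW; apply: (@open_comp _ _ (fun x : F => a * x)) => // x _;
   exact: mulgl_continuous.
Qed.

Lemma open_mulgr W (a : F) : open W -> open [set x | W (x * a)].
Proof.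
by move=> oW; apply: (@open_comp _ _ (fun x : F => x * a)) => // x _;
   exact: mulgr_continuous.
Qed.

Lemma subgroup_open A : is_subgroup A -> nbhs 1 A -> open A.
Proof.
move=> gA nA; rewrite openE => x Ax.
have : nbhs x [set y | A (x^-1 * y)].
  have := @mulgl_continuous x^-1 x.
  by rewrite /continuous_at mulVg => /(_ A nA).
by apply: filterS => y /(subgroupM gA Ax); rewrite mulKVg.
Qed.

Lemma open_subgroupT : open_subgroup setT.
Proof. by split; [apply/is_subgroupP|exact: openT]. Qed.

Lemma open_subgroup_nbhs W : open_subgroup W -> nbhs 1 W.
Proof. by case=> gW oW; apply: open_nbhs_nbhs; split; last exact: subgroup1. Qed.

Lemma open_subgroupI A B : open_subgroup A -> open_subgroup B ->
  open_subgroup (A `&` B).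
Proof. by move=> [gA oA] [gB oB]; split; [exact: subgroupI|exact: openI]. Qed.

Lemma open_subgroupS A W : is_subgroup A -> open_subgroup W -> W `<=` A ->
  open_subgroup A.
Proof.
move=> gA oW WA; split=> //; apply: subgroup_open => //.
by apply: filterS WA _; exact: open_subgroup_nbhs.
Qed.

Lemma open_subgroup_conj W (g : F) : open_subgroup W ->
  open_subgroup [set x | W (g * x * g^-1)].
Proof.
move=> [gW oW]; split; first exact: subgroup_conj.
exact: (@open_mulgl [set x | W (x * g^-1)] g (open_mulgr g^-1 oW)).
Qed.

Lemma open_subgroup_bigcap (I : finType) (f : I -> set F) :
  (forall i, open_subgroup (f i)) -> open_subgroup [set x | forall i, f i x].
Proof.
move=> fo; have -> : [set x | forall i, f i x] = \bigcap_i f i.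
  by apply/seteqP; split => x h i => [_|]; exact: h.
split; first by apply: subgroup_bigcap => i _; case: (fo i).
apply: subgroup_open; first by apply: subgroup_bigcap => i _; case: (fo i).
have := @filter_forall F I f (nbhs (1 : F)) (nbhs_filter (1 : F))
  (fun i => open_subgroup_nbhs (fo i)).
by move=> H; apply: filterS H => x fx i _; exact: fx.
Qed.

Lemma open_subgroup_closed W : open_subgroup W -> closed W.
Proof.
move=> [gW oW]; rewrite -openC openE => x nWx.
have : nbhs x [set y | W (x^-1 * y)].
  apply: open_nbhs_nbhs; split; first exact: open_mulgl.
  by rewrite /= mulVg; exact: subgroup1.
apply: filterS => y Wxy Wy; apply: nWx.
by have := subgroupM gW Wy (subgroupV gW Wxy); rewrite invgM invgK mulKVg.
Qed.

End Open.

(** * Compact totally disconnected spaces *)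

Section Quasicomponent.
Variable T : topologicalType.
Hypotheses (Tc : compact [set: T]) (Th : hausdorff_space T).
Implicit Types (x : T) (K : set T).

(** In a compact Hausdorff space the intersection of the clopen neighbourhoods of
    [x] is connected, hence equal to the connected component of [x]; this is how
    total disconnectedness yields clopen neighbourhoods. *)
Definition quasicomponent x : set T :=
  [set y | forall D : set T, clopen D -> D x -> D y].

(** If every clopen [D] around [x] met [K], the traces [D `&` K] would generate a
    proper filter, and a cluster point of it would lie in [K] and in every [D]. *)
Lemma quasicomponent_separation x K :
  closed K -> (forall y, quasicomponent x y -> ~ K y) ->
  exists D, [/\ clopen D, D x & forall y, D y -> ~ K y].
Proof.
move=> cK QK; apply: contrapT => noD.
pose B := [set D : set T | clopen D /\ D x].
pose G := filter_from B (fun D => D `&` K).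
have GF : Filter G.
  apply: filter_from_filter; first by exists setT; split => //; exact: clopenT.
  move=> D E [cD Dx] [cE Ex]; exists (D `&` E).
    by split; [exact: clopenI|].
  by move=> y [[]].
have GP : ProperFilter G.
  apply: filter_from_proper => D [cD Dx]; apply: contrapT => DK0.
  by apply: noD; exists D; split=> // y Dy Ky; apply: DK0; exists y.
have [p [_ Gp]] := Tc GP filterT.
have GK D : clopen D -> D x -> G (D `&` K) by move=> cD Dx; exists D.
apply: (QK p).
  move=> D cD Dx; have [_ cl] := cD; apply: cl => U /Gp H.
  by have [y [[Dy _] Uy]] := H _ (GK D cD Dx); exists y.
by apply: cK => U /Gp H; have [y [[_ Ky] Uy]] := H _ (GK _ clopenT I); exists y.
Qed.

Lemma quasicomponent_closed x : closed (quasicomponent x).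
Proof.
by move=> y cy D cD Dx; apply: cD.2 => U /cy[z [Qz Uz]]; exists z; split=> //;
   exact: Qz.
Qed.

(** Normality separates [B] and [C] by an open [U] whose closure misses [C]. The
    boundary of [U] then misses the quasicomponent, so some clopen [D] around [x]
    misses the boundary, and [D `&` U] is a clopen set that cuts off [C]. *)
Lemma quasicomponent_indecomposable x (B C : set T) : closed B -> closed C ->
  (forall y, B y -> ~ C y) -> quasicomponent x `<=` B `|` C -> B x ->
  quasicomponent x `<=` B.
Proof.
move=> cB cC BC QBC Bx.
have nB : set_nbhs B (~` C).
  by apply/set_nbhsP; exists (~` C); split => //; exact: closed_openC.
have [E /set_nbhsP[U [oU BU UE]] EC] := compact_normal Th Tc cB nB.
have clUC : closure U `<=` ~` C by apply: subset_trans EC; exact: closure_subset.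
pose K := closure U `&` ~` U.
have cK : closed K by apply: closedI; [exact: closed_closure|exact: open_closedC].
have QK y : quasicomponent x y -> ~ K y.
  by move=> /QBC[/BU Uy [_ /(_ Uy)]|Cy [/clUC/(_ Cy)]].
have [D [[oD cD] Dx DK]] := quasicomponent_separation cK QK.
have DUE : D `&` U = D `&` closure U.
  apply/seteqP; split=> y [Dy Uy]; split=> //; first exact: subset_closure.
  by apply: contrapT => nUy; exact: (DK y Dy).
have cDU : clopen (D `&` U).
  split; first exact: openI.
  by rewrite DUE; apply: closedI => //; exact: closed_closure.
move=> y Qy; have [//|Cy] := QBC _ Qy.
have [_ Uy] := Qy _ cDU (conj Dx (BU _ Bx)).
by case: (clUC y (subset_closure Uy) Cy).
Qed.

Lemma quasicomponent_connected x : connected (quasicomponent x).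
Proof.
move=> B [b Bb] [U oU BU] [C cC BC].
have cQ := @quasicomponent_closed x.
have cB : closed B by rewrite BC; exact: closedI.
have cB' : closed (quasicomponent x `&` ~` U).
  by apply: closedI => //; exact: open_closedC.
have BB' y : B y -> ~ (quasicomponent x `&` ~` U) y.
  by rewrite BU => -[_ Uy] [].
have QBB : quasicomponent x `<=` B `|` (quasicomponent x `&` ~` U).
  move=> y Qy; have [Uy|nUy] := pselect (U y); last by right.
  by left; rewrite BU.
have BQ : B `<=` quasicomponent x by rewrite BU => ? [].
have Qx : quasicomponent x x by [].
have [Bx|nBx] := QBB x Qx.
  by apply/seteqP; split => //; apply: (quasicomponent_indecomposable cB cB').
have QB' : quasicomponent x `<=` quasicomponent x `&` ~` U.
  apply: (@quasicomponent_indecomposable x _ B) => //.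
  - by move=> y By' /BB'.
  - by rewrite setUC.
by case: (BB' b Bb); apply: QB'; exact: BQ.
Qed.

Lemma clopen_nbhs_basis (Td : totally_disconnected [set: T]) x (O : set T) :
  open O -> O x -> exists D, [/\ clopen D, D x & D `<=` O].
Proof.
move=> oO Ox.
have Q1 : quasicomponent x `<=` [set x].
  rewrite -(Td x I); apply: connected_component_max => //.
  exact: quasicomponent_connected.
have [|D [cD Dx DO]] := @quasicomponent_separation x (~` O) (open_closedC oO).
  by move=> y /Q1 ->; apply.
by exists D; split => // y /DO /contrapT.
Qed.

End Quasicomponent.

Lemma compact_nested (T : topologicalType) (A : nat -> set T) :
  compact [set: T] -> (forall n, closed (A n)) -> (forall n, A n !=set0) ->
  (forall n, A n.+1 `<=` A n) -> exists x, forall n, A n x.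
Proof.
move=> Tc cA A0 dA.
have mono m n : (m <= n)%N -> A n `<=` A m.
  move=> /subnK <-; elim: (n - m)%N => [//|k IH].
  by apply: subset_trans IH; exact: dA.
pose G := filter_from [set: nat] A.
have GF : Filter G.
  apply: filter_from_filter; first by exists 0%N.
  move=> i j _ _; exists (maxn i j) => // x Ax.
  by split; apply: mono Ax; [exact: leq_maxl|exact: leq_maxr].
have GP : ProperFilter G by apply: filter_from_proper => n _; exact: A0.
have [p [_ Gp]] := Tc G GP filterT.
exists p => n; apply: cA => U /(Gp (A n)) H.
by apply: H; exists n.
Qed.

(** * Open subgroups of a profinite group *)

Section Profinite.
Variable F : topologicalGroupType.
Hypothesis Fpro : profinite F.
Implicit Types (A W N : set F).

(** For a clopen neighbourhood [D] of 1, the stabiliser of [D] under right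
    translations is a subgroup contained in [D]; it is open because [D] is both
    compact and open. *)
Lemma open_subgroup_basis (O : set F) : open O -> O 1 ->
  exists W, open_subgroup W /\ W `<=` O.
Proof.
case: Fpro => Fc Fh Fd oO O1.
have [D [[oD cD] D1 DO]] := clopen_nbhs_basis Fc Fh Fd oO O1.
pose W : set F := [set g | forall c, D c -> D (c * g) /\ D (c * g^-1)].
have gW : is_subgroup W.
  apply/is_subgroupP; split.
  - by move=> c Dc; rewrite invg1 mulg1.
  - move=> x y Wx Wy c Dc; split.
      by rewrite mulgA; apply: (Wy _ (Wx _ Dc).1).1.
    by rewrite invgM mulgA; apply: (Wx _ (Wy _ Dc).2).2.
  - by move=> x Wx c /Wx; rewrite invgK => -[].
exists W; split; last by move=> g /(_ 1 D1)[]; rewrite mul1g => /DO.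
split=> //; apply: subgroup_open => //.
have cD' : compact D by apply: subclosed_compact Fc _.
have near_mul : \forall g \near (1 : F), D `<=` [set c | D (c * g)].
  apply: (((compact_near_coveringP D).1 cD') F (nbhs (1 : F))
    (fun g c => D (c * g)) (nbhs_filter (1 : F))) => c Dc.
  have := @mulg_continuous F (c, 1 : F).
  rewrite /continuous_at /= mulg1 => /(_ D (open_nbhs_nbhs (conj oD Dc))).
  by [].
have near_mulV : \forall g \near (1 : F), D `<=` [set c | D (c * g^-1)].
  have := @invg_continuous F 1; rewrite /continuous_at invg1 => H.
  exact: (H _ near_mul).
apply: filterS (filterI near_mul near_mulV) => g [Dg DgV] c Dc.
by split; [exact: Dg|exact: DgV].
Qed.

(** A labelling of the right cosets [W x], which are finitely many by
    compactness. *)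
Lemma finite_right_cosets W : open_subgroup W ->
  exists n (cl : F -> 'I_n), forall x y, cl x = cl y <-> W (x * y^-1).
Proof.
move=> [gW oW]; case: Fpro => Fc _ _.
pose F' : ptopologicalType := HB.pack (TopologicalGroup.sort F)
  (isPointed.Build (TopologicalGroup.sort F) 1).
have : compact [set: F'] by [].
rewrite compact_cover => /(_ F' setT (fun g => [set x : F' | W (x * g^-1)])).
case=> [g _| x _|D _ FD].
- exact: (@open_mulgr F).
- by exists x => //=; rewrite mulgV; exact: subgroup1.
pose s : seq F := enum_fset D.
have sP (x : F) : has (fun g => `[< W (x * g^-1) >]) s.
  have [g gD /= Wxg] := FD x I.
  by apply/hasP; exists g => //; exact/asboolP.
exists (size s).
exists (fun x => Ordinal (etrans (esym (has_find _ _)) (sP x))) => x y.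
have W1 z : W (z * (nth 1 s (find (fun g => `[< W (z * g^-1) >]) s))^-1).
  by have /(nth_find 1)/asboolP := sP z.
split=> [[e]|Wxy].
  have := subgroupM gW (W1 x) (subgroupV gW (W1 y)).
  by rewrite e invgM invgK mulgA mulgKV.
apply: val_inj => /=; apply: eq_find => g; apply/asboolP/asboolP => Wg.
  have := subgroupM gW (subgroupV gW Wxy) Wg.
  by rewrite invgM invgK mulgA mulgKV.
by have := subgroupM gW Wxy Wg; rewrite mulgA mulgKV.
Qed.

End Profinite.

Section Cosets.
Variable F : topologicalGroupType.
Hypothesis Fpro : profinite F.
Implicit Types (A W N H : set F).

(** The intersection of the conjugates of [W] only involves finitely many of them,
    one for each coset. *)
Lemma open_normal_core W : open_subgroup W ->
  exists N, [/\ open_subgroup N, N `<=` W &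
    forall g x, N x -> N (g * x * g^-1)].
Proof.
move=> oW; have [n [cl clP]] := finite_right_cosets Fpro oW.
have gW := oW.1.
pose r (c : 'I_n) : F := xget 1 [set x | cl x = c].
have rP x : W (x * (r (cl x))^-1).
  by apply/clP; have := @xgetPex _ 1 [set y | cl y = cl x] (ex_intro _ x erefl).
pose N : set F := [set x | forall c, W (r c * x * (r c)^-1)].
have NP x : N x -> forall g, W (g * x * g^-1).
  move=> Nx g; have := subgroupM gW (subgroupM gW (rP g) (Nx (cl g)))
    (subgroupV gW (rP g)).
  by rewrite invgM invgK !mulgA !mulgKV.
exists N; split.
- by apply: open_subgroup_bigcap => c; exact: open_subgroup_conj.
- by move=> x /NP/(_ 1); rewrite invg1 mulg1 mul1g.
- move=> g x /NP h c /=.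
  by have := h (r c * g); rewrite invgM !mulgA.
Qed.

Lemma open_subgroup_mul H N : is_subgroup H -> open_subgroup N ->
  (forall g x, N x -> N (g * x * g^-1)) ->
  open_subgroup [set z | exists2 h, H h & N (h^-1 * z)].
Proof.
move=> gH oN nN; have gN := oN.1; set W := [set z | _].
have gW : is_subgroup W.
  apply/is_subgroupP; split.
  - by exists 1; [exact: subgroup1|rewrite invg1 mulg1; exact: subgroup1].
  - move=> a b [h Hh Nha] [k Hk Nkb]; exists (h * k); first exact: subgroupM.
    have := subgroupM gN (nN k^-1 _ Nha) Nkb.
    by rewrite invgK !mulgA mulgK invgM.
  - move=> a [h Hh Nha]; exists h^-1; first exact: subgroupV.
    have := nN h _ (subgroupV gN Nha).
    by rewrite !invgM !invgK !mulgA mulgK.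
apply: (open_subgroupS gW oN) => z Nz; exists 1; first exact: subgroup1.
by rewrite invg1 mul1g.
Qed.

Lemma closed_subgroup_separation H x : is_subgroup H -> closed H -> ~ H x ->
  exists W, [/\ open_subgroup W, H `<=` W & ~ W x].
Proof.
move=> gH cH nHx.
have oO : open [set u | ~ H (x * u)].
  exact: (@open_mulgl _ (~` H) x (closed_openC cH)).
have [|W0 [oW0 W0O]] := open_subgroup_basis Fpro oO; first by rewrite /= mulg1.
have [N [oN NW0 nN]] := open_normal_core oW0.
have gN := oN.1.
have oW := open_subgroup_mul gH oN nN.
exists [set z | exists2 h, H h & N (h^-1 * z)]; split=> //.
- by move=> h Hh; exists h => //; rewrite mulVg; exact: subgroup1.
- move=> [h Hh /(subgroupV gN)/NW0/W0O /=].
  by rewrite invgM invgK mulKVg.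
Qed.

Definition coset_system (U V : set F) (C : finType) (cl : F -> C)
    (rep : C -> F) :=
  [/\ forall c, U (rep c), forall c, cl (rep c) = c &
      forall x y, U x -> U y -> (cl x = cl y <-> V (x * y^-1))].

Lemma coset_system_exists (U V : set F) : is_subgroup U -> open_subgroup V ->
  exists (C : finType) (cl : F -> C) (rep : C -> F), coset_system U V cl rep.
Proof.
move=> gU oV; have [n [cl0 clP]] := finite_right_cosets Fpro oV.
pose P := fun c : 'I_n => `[< exists2 u, U u & cl0 u = c >].
have P1 : P (cl0 1) by apply/asboolP; exists 1 => //; exact: subgroup1.
pose c1 : {c | P c} := exist _ (cl0 1) P1.
pose cl (x : F) : {c | P c} := insubd c1 (cl0 x).
have clE x : U x -> val (cl x) = cl0 x.
  by move=> Ux; rewrite insubdK //; apply/asboolP; exists x.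
have rP (c : {c | P c}) : exists x, U x /\ cl x = c.
  have /asboolP[x Ux e] := valP c; exists x; split => //.
  by apply: val_inj; rewrite clE.
have [rep repP] := choice rP.
exists {c | P c}, cl, rep; split => [c|c|x y Ux Uy]; try by case: (repP c).
rewrite -clP -clE// -clE//; split => [->//|]; exact: val_inj.
Qed.

End Cosets.

(** * Homomorphisms to finite groups and free bases *)

Section Hom.
Variable F : topologicalGroupType.
Implicit Types (U V W : set F) (K : finGroupType).

(** Triviality on the trace of an open subgroup is continuity for the topology that
    [V] inherits from [F]. *)
Definition hom_on V K (f : F -> K) :=
  (forall x y, V x -> V y -> f (x * y) = f x * f y) /\
  exists N, open_subgroup N /\ forall x, V x -> N x -> f x = 1.

Lemma hom_onM V K (f : F -> K) x y : hom_on V f -> V x -> V y ->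
  f (x * y) = f x * f y.
Proof. by case=> + _; apply. Qed.

Lemma hom_on1 V K (f : F -> K) : is_subgroup V -> hom_on V f -> f 1 = 1.
Proof.
move=> gV hf; have V1 := subgroup1 gV; apply: (mulgI (f 1)).
by rewrite -(hom_onM hf)// !mulg1.
Qed.

Lemma hom_onV V K (f : F -> K) x : is_subgroup V -> hom_on V f -> V x ->
  f x^-1 = (f x)^-1.
Proof.
move=> gV hf Vx; apply: (mulgI (f x)).
by rewrite -(hom_onM hf) ?mulgV ?(hom_on1 gV hf)//; exact: subgroupV.
Qed.

Lemma hom_onS U V K (f : F -> K) : V `<=` U -> hom_on U f -> hom_on V f.
Proof.
move=> VU [fM [N [oN fN]]]; split; first by move=> x y /VU ? /VU; exact: fM.
by exists N; split => // x /VU; exact: fN.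
Qed.

(** The kernel of [f] on the open subgroup [V] is open. *)
Lemma hom_on_open V A K (f : F -> K) : open_subgroup V -> hom_on V f ->
  is_subgroup A -> (forall x, V x -> f x = 1 -> A x) -> open_subgroup A.
Proof.
move=> oV [_ [N [oN fN]]] gA VA.
apply: (open_subgroupS gA (open_subgroupI oV oN)) => x [Vx Nx].
exact/VA/fN.
Qed.

Lemma hom_on_preim V K (f : F -> K) (T : {group K}) : open_subgroup V ->
  hom_on V f -> open_subgroup (V `&` [set x | f x \in T]).
Proof.
move=> oV hf; have gV := oV.1.
apply: (hom_on_open oV hf) => [|x Vx /= ->]; last by split => //=; exact: group1.
apply/is_subgroupP; split.
- split; [exact: subgroup1|by rewrite /= (hom_on1 gV hf) group1].
- move=> x y [Vx Tx] [Vy Ty]; split; first exact: subgroupM.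
  by rewrite /= (hom_onM hf)// groupM.
- move=> x [Vx Tx]; split; first exact: subgroupV.
  by rewrite /= (hom_onV gV hf)// groupV.
Qed.

Lemma hom_on_eq V K (f g : F -> K) : open_subgroup V ->
  hom_on V f -> hom_on V g -> open_subgroup (V `&` [set x | f x = g x]).
Proof.
move=> oV hf [gM [N [oN gN]]]; have hg : hom_on V g by split=> //; exists N.
have gV := oV.1; have [fM [M [oM fM1]]] := hf.
have gA : is_subgroup (V `&` [set x | f x = g x]).
  apply/is_subgroupP; split.
  - split; first exact: subgroup1.
    by rewrite /= (hom_on1 gV hf) (hom_on1 gV hg).
  - move=> x y [Vx e] [Vy e']; split; first exact: subgroupM.
    by rewrite /= fM// gM// e e'.
  - move=> x [Vx e]; split; first exact: subgroupV.
    by rewrite /= (hom_onV gV hf)// (hom_onV gV hg)// e.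
apply: (open_subgroupS gA (open_subgroupI oV (open_subgroupI oN oM))).
by move=> x [Vx [Nx Mx]]; split => //=; rewrite gN// fM1.
Qed.

Lemma hom_on_comp V K K' (f : F -> K) (T : {set K}) (p : K -> K') :
  is_subgroup V -> hom_on V f -> (forall x, V x -> f x \in T) ->
  {in T &, {morph p : a b / a * b}} -> hom_on V (p \o f).
Proof.
move=> gV hf fT pM; have [_ [N [oN fN]]] := hf.
have p1 : p 1 = 1.
  have T1 : 1 \in T by rewrite -(hom_on1 gV hf); apply/fT/(subgroup1 gV).
  by apply: (mulgI (p 1)); rewrite -pM// mulg1 [RHS]mulg1.
split; first by move=> x y Vx Vy /=; rewrite (hom_onM hf)// pM ?fT.
by exists N; split => // x Vx Nx /=; rewrite fN.
Qed.

(** A finite basis of the open subgroup [U] as a free profinite group. That the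
    closed subgroup generated by [y] is [U] is expressed through the open
    subgroups of [F], of which a closed subgroup is the intersection. *)
Definition free_basis U (I : finType) (y : I -> F) :=
  [/\ forall i, U (y i),
      forall W, open_subgroup W -> (forall i, W (y i)) -> U `<=` W &
      forall K (a : I -> K), exists g, hom_on U g /\ forall i, g (y i) = a i].

Lemma free_basis_hom_eq U (I : finType) (y : I -> F) K (f g : F -> K) :
  open_subgroup U -> free_basis U y -> hom_on U f -> hom_on U g ->
  (forall i, f (y i) = g (y i)) -> forall x, U x -> f x = g x.
Proof.
move=> oU [Uy gen _] hf hg fg x Ux.
have [|_ //] := gen _ (hom_on_eq oU hf hg) _ x Ux.
by move=> i; split => //=.
Qed.

(** Projectivity: a homomorphism from a free group lifts through a surjection, with
    prescribed lifts on the basis. *)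
Lemma free_basis_lift U (I : finType) (y : I -> F) K K' (B : {group K})
    (p : K -> K') (f : F -> K') (b : I -> K) :
  open_subgroup U -> free_basis U y -> hom_on U f ->
  {in B &, {morph p : a b / a * b}} ->
  (forall i, b i \in B) -> (forall i, p (b i) = f (y i)) ->
  exists g, [/\ hom_on U g, forall x, U x -> g x \in B,
    forall x, U x -> p (g x) = f x & forall i, g (y i) = b i].
Proof.
move=> oU yb hf pM bB pb; have [Uy gen univ] := yb.
have [g [hg gb]] := univ K b.
have gB x : U x -> g x \in B.
  move=> Ux; have [|_ //] := gen _ (hom_on_preim B oU hg) _ x Ux.
  by move=> i; split => //=; rewrite gb.
exists g; split => //; apply: (free_basis_hom_eq oU yb (f := p \o g)) => //.
  exact: (hom_on_comp oU.1 hg gB pM).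
by move=> i /=; rewrite gb.
Qed.

End Hom.

(** * The Nielsen-Schreier theorem for open subgroups *)

Section Schreier.
Variable F : topologicalGroupType.
Variables (U V : set F) (I : finType) (y : I -> F).
Hypotheses (oU : open_subgroup U) (oV : open_subgroup V).
Hypotheses (VU : V `<=` U) (yb : free_basis U y).
Variables (C : finType) (cl : F -> C) (rep : C -> F).
Hypothesis csys : coset_system U V cl rep.

Let gU : is_subgroup U := oU.1.
Let Uy i : U (y i). Proof. by case: yb. Qed.
Let Urep c : U (rep c). Proof. by case: csys. Qed.
Let repK c : cl (rep c) = c. Proof. by case: csys. Qed.
Let clP x z : U x -> U z -> (cl x = cl z <-> V (x * z^-1)).
Proof. by case: csys => _ _; apply. Qed.

(** The right action of [U] on the cosets of [V]. *)
Definition coset_act c u := cl (rep c * u).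
Local Notation act := coset_act.
Local Notation base := (cl 1).

Lemma coset_act_cl x u : U x -> U u -> act (cl x) u = cl (x * u).
Proof.
move=> Ux Uu; have Urx : U (rep (cl x)) by [].
have /clP -/(_ Urx Ux) := repK (cl x) => Vx.
apply/clP; [exact: (subgroupM gU)|exact: (subgroupM gU)|].
by rewrite invgM mulgA mulgK.
Qed.

Lemma coset_act1 c : act c 1 = c.
Proof. by rewrite /act mulg1 repK. Qed.

Lemma coset_actM c u v : U u -> U v -> act c (u * v) = act (act c u) v.
Proof.
by move=> Uu Uv; rewrite [RHS](coset_act_cl (subgroupM gU (Urep c) Uu) Uv) -mulgA.
Qed.

Lemma coset_actK c u : U u -> act (act c u) u^-1 = c.
Proof.
by move=> Uu; rewrite -coset_actM ?mulgV ?coset_act1//; exact: (subgroupV gU).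
Qed.

Lemma coset_act_inj u : U u -> injective (act^~ u).
Proof. by move=> Uu c c' e; rewrite -(coset_actK c Uu) e coset_actK. Qed.

Lemma coset_act_base u : U u -> act base u = cl u.
Proof. by move=> Uu; rewrite coset_act_cl ?mul1g//; exact: (subgroup1 gU). Qed.

Lemma coset_act_base_V v : V v -> act base v = base.
Proof.
move=> Vv; rewrite coset_act_base; last exact: VU.
apply/clP; [exact: VU|exact: (subgroup1 gU)|by rewrite invg1 mulg1].
Qed.

Lemma coset_kernel_open : exists N, [/\ open_subgroup N, N `<=` U &
  forall u c, N u -> act c u = c].
Proof.
have oN := open_subgroup_bigcap (fun c => open_subgroup_conj (rep c) oV).
exists (U `&` [set u | forall c, V (rep c * u * (rep c)^-1)]).
split; [exact: open_subgroupI|by move=> u []|move=> u c [Uu Nu]].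
rewrite -[RHS]repK; apply/clP => //; exact: (subgroupM gU).
Qed.

(** A proper set of cosets containing the base coset cannot be stable under the
    generators: each acts as a permutation of a finite set, so a stable set would
    be stable under the whole group, which acts transitively. This lets the
    spanning tree below grow along generators only, never along inverses. *)
Lemma coset_exit (S : {set C}) : base \in S -> S != finset.setT ->
  exists c i, c \in S /\ act c (y i) \notin S.
Proof.
move=> bS /eqP nST; apply: contrapT => noexit.
have stay c i : c \in S -> act c (y i) \in S.
  by move=> cS; apply: contrapT => /negP nS; apply: noexit; exists c, i.
pose W : set F := U `&` [set u | forall c, c \in S -> act c u \in S].
have gW : is_subgroup W.
  apply/is_subgroupP; split.
  - by split; [exact: (subgroup1 gU)|move=> c cS; rewrite coset_act1].
  - move=> u v [Uu Su] [Uv Sv]; split; first exact: (subgroupM gU).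
    by move=> c /Su /Sv; rewrite coset_actM.
  - move=> u [Uu Su]; split; first exact: (subgroupV gU).
    have imS : act^~ u @: S = S.
      apply/eqP; rewrite eqEcard card_imset ?leqnn ?andbT; last first.
        exact: coset_act_inj.
      by apply/fintype.subsetP => _ /imsetP[c cS ->]; exact: Su.
    by move=> c; rewrite -{1}imS => /imsetP[c' c'S ->]; rewrite coset_actK.
have oW : open_subgroup W.
  have [N [oN NU fixN]] := coset_kernel_open.
  apply: (open_subgroupS gW oN) => u Nu; split; first exact: NU.
  by move=> c; rewrite fixN.
have [_ gen _] := yb.
have UW : U `<=` W by apply: gen => // i; split=> // c; exact: stay.
apply: nST; apply/setP => c; rewrite inE -[c]repK -coset_act_base //.
by have [_ ->] := UW _ (Urep c).
Qed.

(** A cocycle on the action of [U] on the cosets with values in [K]; its value at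
    the base coset restricts to a homomorphism on [V]. *)
Definition cocycle (K : finGroupType) (b : C -> F -> K) :=
  forall c u v, U u -> U v -> b c (u * v) = b c u * b (act c u) v.

Lemma cocycle1 (K : finGroupType) (b : C -> F -> K) c : cocycle b -> b c 1 = 1.
Proof.
move=> bM; have U1 := subgroup1 gU; apply: (mulgI (b c 1)).
by rewrite -[X in _ * b X _](coset_act1 c) -bM// !mulg1.
Qed.

(** A tree on the vertex set [S] in the Schreier graph, whose edges [(c, i)] go from
    [c] to [c y_i]; [t c] is the word read along the tree from the base coset to
    [c]. The last clause says so without mentioning words: a cocycle trivial on
    the edges is trivial along the paths of the tree. *)
Definition spanning_tree (S : {set C}) (E : {set C * I}) (t : C -> F) :=
  [/\ t base = 1, base \in S, #|E| < #|S|,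
   (forall c, c \in S -> U (t c) /\ cl (t c) = c) &
   (forall e, e \in E -> let c' := act e.1 (y e.2) in
      [/\ e.1 \in S, c' \in S, e.1 != c' & t c' = t e.1 * y e.2]) /\
   (forall (K : finGroupType) (b : C -> F -> K), cocycle b ->
      (forall e, e \in E -> b e.1 (y e.2) = 1) ->
      forall c, c \in S -> b base (t c) = 1)].

Lemma spanning_tree_exists : exists E t, spanning_tree finset.setT E t.
Proof.
suff H n : (n < #|C|)%N -> exists S E t, spanning_tree S E t /\ #|S| = n.+1.
  have C0 : (0 < #|C|)%N by apply/card_gt0P; exists base.
  have [|S [E [t [tr]]]] := H #|C|.-1; first by rewrite prednK.
  rewrite prednK// => /eqP cS; exists E, t.
  suff -> : finset.setT = S by [].
  by apply/esym/eqP; rewrite eqEcard finset.subsetT finset.cardsT (eqP cS) leqnn.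
elim: n => [_|n IH nC].
  exists [set base]%SET, finset.set0, (fun=> 1); rewrite cards1; split=> //.
  split=> //; first by rewrite inE.
  - by rewrite cards0 cards1.
  - move=> c; rewrite inE => /eqP ->.
    by split => //; exact: (subgroup1 gU).
  - split=> [e|K b bM _ c _]; first by rewrite finset.in_set0.
    exact: cocycle1.
have [S [E [t [[t1 bS ES tP [EP bP]] cS]]]] := IH (ltnW nC).
have [|c [i [cinS c'S]]] := coset_exit bS.
  by apply: contraTneq nC => ST; rewrite -cS ST finset.cardsT ltnn.
set c' := act c (y i) in c'S.
have [Utc tcK] := tP c cinS.
pose t' x := if x == c' then t c * y i else t x.
have t'S x : x \in S -> t' x = t x.
  by rewrite /t'; case: eqP => // -> xS; rewrite xS in c'S.
exists (c' |: S), ((c, i) |: E), t'; split; last first.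
  by rewrite cardsU1 c'S cS.
split.
- by rewrite t'S.
- by rewrite !inE bS orbT.
- by rewrite !cardsU1 c'S; apply: leq_ltn_trans (leq_add (leq_b1 _) (leqnn _)) _.
- move=> x; rewrite !inE => /orP[/eqP->|xS]; last by rewrite t'S //; exact: tP.
  rewrite /t' eqxx; split.
  + exact: (subgroupM gU).
  + by rewrite -coset_act_cl // tcK.
- split.
    move=> e; rewrite !inE => /orP[/eqP->|eE] /=.
      rewrite -/c' !inE cinS eqxx orbT (t'S c) //; split => //.
      + by apply: contraNneq c'S => <-.
      + by rewrite /t' eqxx.
    have [e1S e2S ne te] := EP _ eE.
    by rewrite !inE e1S e2S !orbT !t'S.
  move=> K b bM bE x; rewrite !inE => /orP[/eqP->|xS]; last first.
    rewrite t'S//; apply: bP => // e eE; apply: bE.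
    by rewrite !inE eE orbT.
  have E1 := subgroup1 gU; rewrite /t' eqxx bM//.
  rewrite coset_act_base// tcK bP//; last first.
    by move=> e eE; apply: bE; rewrite !inE eE orbT.
  by rewrite mul1g (bE (c, i))// !inE eqxx.
Qed.

(** Labels on the edges of the Schreier graph extend to a cocycle. The free basis of
    [U] is mapped to the permutations [(c, k) |-> (c y_i, k * l c i)] of [C * K];
    these commute with left multiplication on [K], so that the image of [(c, 1)]
    determines the image of every [(c, k)] and the second coordinates form a
    cocycle. This plays the role of the wreath product. *)
Lemma cocycle_extension (K : finGroupType) (l : C -> I -> K) :
  exists b, [/\ cocycle b, hom_on V (b base) &
     forall c i, b c (y i) = l c i].
Proof.
pose q i (x : C * K) := (act x.1 (y i), x.2 * l x.1 i).
have q_inj i : injective (q i).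
  move=> [c k] [c' k'] [/(coset_act_inj (Uy i)) <-].
  by move/mulIg <-.
have [_ gen univ] := yb.
have [g [hg gq]] := univ {perm (C * K)} (fun i => perm (q_inj i)).
pose b c u := (g u (c, 1)).2.
pose W : set F := U `&` [set u | forall c k, g u (c, k) = (act c u, k * b c u)].
have gW : is_subgroup W.
  apply/is_subgroupP; split.
  - split; first exact: (subgroup1 gU).
    by move=> c k; rewrite /b (hom_on1 gU hg) !perm1 coset_act1 mulg1.
  - move=> u v [Uu Wu] [Uv Wv]; split; first exact: (subgroupM gU).
    move=> c k; rewrite /b (hom_onM hg)// !permM !Wu !Wv coset_actM//=.
    by rewrite mul1g mulgA.
  - move=> u [Uu Wu]; split; first exact: (subgroupV gU).
    have UuV := subgroupV gU Uu.
    have gV1 c k : (g u)^-1 (c, k) = (act c u^-1, k * (b (act c u^-1) u)^-1).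
      apply: (canLR (permK (g u))); rewrite Wu mulgKV -coset_actM//.
      by rewrite mulVg coset_act1.
    by move=> c k; rewrite /b (hom_onV gU hg)// !gV1 mul1g.
have oW : open_subgroup W.
  have [N [oN NU fixN]] := coset_kernel_open.
  have [_ [M [oM gM]]] := hg.
  apply: (open_subgroupS gW (open_subgroupI oN oM)) => u [Nu Mu].
  split=> [|c k]; first exact: NU.
  by rewrite /b gM ?perm1 ?fixN ?mulg1//; exact: NU.
have UW u c k : U u -> g u (c, k) = (act c u, k * b c u).
  move=> Uu; have [|_ -> //] := gen W oW _ u Uu.
  by move=> i; split=> // c' k'; rewrite /b gq !permE /q /= mul1g.
have bM : cocycle b.
  move=> c u v Uu Uv; rewrite {1}/b (hom_onM hg)// permM UW// UW//.
  by rewrite mul1g.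
exists b; split => //.
- split.
    by move=> u v /[dup] /VU Uu Vu /VU Uv; rewrite bM// coset_act_base_V.
  have [_ [N [oN gN]]] := hg.
  by exists N; split => // u /VU Uu Nu; rewrite /b gN // perm1.
- by move=> c i; rewrite /b gq permE /q /= mul1g.
Qed.

(** The Schreier generators [t c * y i * (t (c y_i))^-1] of the edges outside a
    spanning tree. They are free because labels on these edges, completed by 1 on
    the tree, extend to a cocycle, which takes at each generator the value of its
    label. A basis element [y i] of [U] lying in [V] is the generator of a loop
    at the base coset, and a loop is never in the tree. *)
Lemma schreier_basis : exists (J : finType) (z : J -> F),
  [/\ free_basis V z, (#|C| * #|I| < #|J| + #|C|)%N &
     forall i, V (y i) -> exists j, z j = y i].
Proof.
have [E [t [t1 _ cE tP [EP bP]]]] := spanning_tree_exists.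
have Ut c : U (t c) by case: (tP c (finset.in_setT _)).
have tK c : cl (t c) = c by case: (tP c (finset.in_setT _)).
pose z0 c i := t c * y i * (t (act c (y i)))^-1.
have Vz c i : V (z0 c i).
  apply/clP => //; first exact: (subgroupM gU).
  by rewrite tK -coset_act_cl // tK.
pose J := {e : C * I | e \notin E}.
pose z (j : J) := z0 (val j).1 (val j).2.
have zE e : e \in E -> z0 e.1 e.2 = 1.
  by move=> /EP[_ _ _ /= e1]; rewrite /z0 e1 mulgV.
exists J, z; split.
- split.
  + by move=> j; exact: Vz.
  + move=> W oW Wz.
    have gW := oW.1.
    have Wz0 c i : W (z0 c i).
      case: (boolP ((c, i) \in E)) => [/zE/= ->|nE]; first exact: (subgroup1 gW).
      exact: (Wz (exist _ (c, i) nE)).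
    (* The elements all of whose rewritings as a product of Schreier
       generators, started at any coset, lie in W. *)
    pose Q : set F := U `&` [set u | forall c, W (t c * u * (t (act c u))^-1)].
    have gQ : is_subgroup Q.
      apply/is_subgroupP; split.
      * split; first exact: (subgroup1 gU).
        by move=> c; rewrite coset_act1 mulg1 mulgV; exact: (subgroup1 gW).
      * move=> u v [Uu Qu] [Uv Qv]; split; first exact: (subgroupM gU).
        move=> c; have := subgroupM gW (Qu c) (Qv (act c u)).
        by rewrite -coset_actM// !mulgA mulgKV.
      * move=> u [Uu Qu]; have UuV := subgroupV gU Uu; split => //.
        move=> c; have := subgroupV gW (Qu (act c u^-1)).
        rewrite -coset_actM// mulVg coset_act1.
        by rewrite !invgM invgK mulgA.
    have oQ : open_subgroup Q.
      have [N [oN NU fixN]] := coset_kernel_open.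
      have oN' := open_subgroup_bigcap (fun c => open_subgroup_conj (t c) oW).
      apply: (open_subgroupS gQ (open_subgroupI oN oN')) => u [Nu N'u].
      split=> [|c]; first exact: NU.
      by rewrite /= fixN //; exact: N'u.
    have [_ gen _] := yb.
    have UQ : U `<=` Q by apply: gen => // i; split => // c; exact: Wz0.
    move=> v Vv; have [_ /(_ base)] := UQ v (VU Vv).
    by rewrite coset_act_base_V// t1 mul1g invg1 mulg1.
  + move=> K a.
    pose l c i := if insub (c, i) is Some j then a j else 1.
    have [b [bM hb bl]] := cocycle_extension l.
    exists (b base); split => // j.
    have btP c : b base (t c) = 1.
      apply: bP => //.
      by move=> -[c' i] eE /=; rewrite bl /l insubF ?eE.
    have := bM base (z j) (t (act (val j).1 (y (val j).2))) (VU (Vz _ _)) (Ut _).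
    rewrite {1}/z /z0 mulgKV bM// btP mul1g coset_act_base// tK bl.
    rewrite coset_act_base_V; last exact: Vz.
    rewrite btP mulg1 => <-.
    by rewrite /l -surjective_pairing valK.
- rewrite card_sig.
  have -> : #|[pred x | x \notin E]| = (#|C| * #|I| - #|E|)%N.
    have := cardC (mem E); rewrite card_prod => <-.
    by rewrite addKn.
  have : (#|E| <= #|C| * #|I|)%N by rewrite -card_prod max_card.
  rewrite finset.cardsT in cE.
  by move=> /subnK {1}<-; rewrite ltn_add2l.
- move=> i Vyi.
  have nE : (base, i) \notin E.
    apply/negP => /EP[_ _ /=]; rewrite coset_act_base_V//.
    by rewrite eqxx.
  exists (exist _ (base, i) nE).
  by rewrite /z /z0 /= coset_act_base_V// t1 mul1g invg1 mulg1.
Qed.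

End Schreier.

Section Nielsen.
Variable F : topologicalGroupType.
Hypothesis Fpro : profinite F.

(** A spanning tree has one edge less than there are cosets, so at least
    [#|C| * (#|I| - 1) + 1] Schreier generators remain; this exceeds [#|I|] as
    soon as there are two cosets and two basis elements. *)
Lemma nielsen_schreier (U V : set F) (I : finType) (y : I -> F) :
  open_subgroup U -> open_subgroup V -> V `<=` U -> free_basis U y ->
  exists (J : finType) (z : J -> F),
  [/\ free_basis V z, (#|I| <= #|J|)%N,
     (1 < #|I|)%N -> ~ U `<=` V -> (#|I| < #|J|)%N &
     forall i, V (y i) -> exists j, z j = y i].
Proof.
move=> oU oV VU yb.
have [C [cl [rep csys]]] := coset_system_exists Fpro oU.1 oV.
have [J [z [zb cJ zy]]] := schreier_basis oU oV VU yb csys.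
have C0 : (0 < #|C|)%N by apply/card_gt0P; exists (cl 1).
exists J, z; split => //; first by clear -cJ C0; nia.
move=> I1 nUV; suff C1 : (1 < #|C|)%N by clear -cJ C1 I1; nia.
have [repU repK clP] := csys.
apply: contrapT => C1; apply: nUV => u Uu.
have /fintype_le1P C1' : (#|C| <= 1)%N by rewrite leqNgt; apply/negP.
have U1 := subgroup1 oU.1.
by have := (clP u 1 Uu U1).1 (C1' _ _); rewrite invg1 mulg1.
Qed.

End Nielsen.

(** * The ambient group has a finite basis of at least two elements *)

Section FiniteBasis.
Variable F : topologicalGroupType.
Hypothesis Fpro : profinite F.
Implicit Types (X W N : set F).

Lemma generates_open_subgroup X W : generates X -> open_subgroup W ->
  X `<=` W -> forall x, W x.
Proof.
move=> Xgen [gW oW] XW x.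
have [||y [Wy Xy]] := Xgen [set y | W (x^-1 * y)].
- by exists x; rewrite /= mulVg; exact: subgroup1.
- exact: open_mulgl.
have {}Xy : W y by apply: Xy; split.
have := subgroupM gW Xy (subgroupV gW Wy).
by rewrite invgM invgK mulKVg.
Qed.

Lemma continuous_hom_on (K : finGroupType) (f : F -> K) : continuous_hom f ->
  hom_on setT f.
Proof.
move=> [fM fc]; split => [x y _ _|]; first exact: fM.
have f1 : f 1 = 1 by apply: (mulgI (f 1)); rewrite -fM !mulg1.
exists [set x | f x = 1]; split => //; split.
  apply/is_subgroupP; split => //=.
  - by move=> x y e e'; rewrite fM e e' mulg1.
  - move=> x e; apply: (mulgI (f x)).
    by rewrite -fM mulgV f1 e mulg1.
apply: (@open_comp _ _ (f : F -> discrete_topology K) [set (1 : K)]).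
  by move=> x _; exact: fc.
exact: discrete_open.
Qed.

(** Each element [x] of a basis has its own homomorphism to a group of order 2,
    nontrivial at [x] only, while there are only finitely many homomorphisms to
    this group, as they are determined on a finite generating set. *)
Lemma profinite_basis_finite X : finitely_generated F -> profinite_basis X ->
  finite_set X.
Proof.
move=> [Z [/finite_seqP[s ->] sgen]] [_ _ univ].
pose k0 : {perm bool} := tperm true false.
have k01 : k0 <> 1.
  by move=> /(congr1 (fun p : {perm bool} => p true)); rewrite tpermL perm1.
have phiP x : exists phi : F -> {perm bool}, X x ->
    [/\ hom_on setT phi, phi x = k0 & forall z, X z -> z <> x -> phi z = 1].
  have [Xx|nXx] := pselect (X x); last by exists (fun=> 1).
  pose a z := if z == x then k0 else 1.
  have [|phi [hphi phia]] := univ _ a.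
    apply: sub_finite_set (finite_set1 x) => z [_]; rewrite /a.
    by case: eqP => // ->.
  exists phi => _; split; first exact: continuous_hom_on.
    by rewrite phia// /a eqxx.
  by move=> z Xz /eqP/negbTE zx; rewrite phia// /a zx.
have [phi {}phiP] := choice phiP.
pose r x : {ffun 'I_(size s) -> {perm bool}} :=
  [ffun i : 'I_(size s) => phi x (nth 1 s i)].
apply: contrapT => /infinite_set_fsetP/(_ #|{ffun 'I_(size s) -> {perm bool}}|.+1).
case=> B BX; apply/negP; rewrite -ltnNge ltnS cardfE.
have r_inj : injective (fun b : B => r (val b)).
  move=> b c rbc; apply: val_inj; apply: contrapT => bc.
  have [hb bk b1] := phiP _ (BX _ (valP b)).
  have [hc ck c1] := phiP _ (BX _ (valP c)).
  have oW := hom_on_eq (@open_subgroupT F) hb hc.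
  have [] := generates_open_subgroup sgen oW _ (val b).
    move=> z /= zs; split => //=; have zi := zs; rewrite -index_mem in zi.
    have /ffunP/(_ (Ordinal zi)) := rbc.
    by rewrite !ffunE /= nth_index.
  by move=> _ /=; rewrite bk c1//; exact: BX (valP b).
exact: leq_card r_inj.
Qed.

(** Modulo an open normal subgroup, an element commuting with the basis is
    central. *)
Lemma commutator_mod N (I : finType) (y : I -> F) a : free_basis setT y ->
  open_subgroup N -> (forall g x, N x -> N (g * x * g^-1)) ->
  (forall i, N (y i * a * (y i)^-1 * a^-1)) ->
  forall x, N (x * a * x^-1 * a^-1).
Proof.
move=> [_ gen _] oN nN yN x; have gN := oN.1.
suff oW : open_subgroup [set x | N (x * a * x^-1 * a^-1)] by exact: (gen _ oW).
have gW : is_subgroup [set x | N (x * a * x^-1 * a^-1)].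
  apply/is_subgroupP; split => /=.
  - by rewrite mul1g invg1 mulg1 mulgV; exact: (subgroup1 gN).
  - move=> u v Nu Nv; have := subgroupM gN (nN u _ Nv) Nu.
    by rewrite invgM !mulgA !mulgKV.
  - move=> u /(subgroupV gN)/(nN u^-1).
    by rewrite !invgM !invgK !mulgA mulgKV.
apply: (open_subgroupS gW oN) => u Nu /=.
have := subgroupM gN Nu (nN a _ (subgroupV gN Nu)).
by rewrite !mulgA.
Qed.

Lemma open_normal_separation (x : F) : x <> 1 -> exists N,
  [/\ open_subgroup N, forall g z, N z -> N (g * z * g^-1) & ~ N x].
Proof.
move=> x1; have [_ Fh _] := Fpro.
have [|||W [oW W1 nWx]] := @closed_subgroup_separation F Fpro [set 1] x.
- apply/is_subgroupP; split => //= [u v -> ->|u ->]; first by rewrite mulg1.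
  by rewrite invg1.
- exact: (accessible_closed_set1 (hausdorff_accessible Fh)).
- exact: x1.
have [N [oN NW nN]] := open_normal_core Fpro oW.
by exists N; split => //; move=> /NW.
Qed.

Lemma nonabelian_free_basis (I : finType) (y : I -> F) : nonabelian F ->
  free_basis setT y -> (1 < #|I|)%N.
Proof.
move=> [a [b ab]] yb; rewrite ltnNge; apply/negP => /fintype_le1P I1.
have [|N [oN nN]] := @open_normal_separation (a * b * a^-1 * b^-1).
  move=> e; apply: ab; have := congr1 (fun z => z * b * a) e.
  by rewrite /= mulgKV mulgKV mul1g => ->.
have gN := oN.1.
apply; apply: (commutator_mod yb oN nN) => i.
have := @commutator_mod N I y (y i) yb oN nN _ b.
move=> H; have {}H : N (b * y i * b^-1 * (y i)^-1).
  apply: H => j; rewrite (I1 j i) mulgK mulgV; exact: (subgroup1 gN).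
have := subgroupV gN H.
by rewrite !invgM !invgK !mulgA.
Qed.

Lemma finite_free_basis X : finitely_generated F -> profinite_basis X ->
  exists n (y : 'I_n -> F), free_basis setT y.
Proof.
move=> Ffg Xb; have [s sX] := (finite_seqP _).1 (profinite_basis_finite Ffg Xb).
have [Xgen _ univ] := Xb.
have Xs x : X x <-> x \in undup s by rewrite mem_undup sX.
have us := undup_uniq s.
exists (size (undup s)), (fun i => nth 1 (undup s) i); split => //.
- move=> W oW Wy x _; apply: (generates_open_subgroup Xgen oW) => z.
  move=> /Xs zs; have zi := zs; rewrite -index_mem in zi.
  by have := Wy (Ordinal zi); rewrite /= nth_index.
- move=> K a.
  pose b (x : F) := if insub (index x (undup s)) is Some i then a i else 1.
  have [|g [hg gb]] := univ K b.
    by apply: (sub_finite_set _ (profinite_basis_finite Ffg Xb)) => x [].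
  exists g; split; first exact: continuous_hom_on.
  move=> i; rewrite gb; last by apply/Xs; exact: mem_nth.
  by rewrite /b index_uniq// valK.
Qed.

End FiniteBasis.

(** * Enlarging the subgroup *)

Section Chain.
Variable F : topologicalGroupType.
Hypothesis Fpro : profinite F.
Implicit Types (P U W N L : set F).

(** The closed subgroup generated by [P] and [z]. *)
Definition adjoin P (z : F) : set F :=
  [set x | forall W, open_subgroup W -> P `<=` W -> W z -> W x].

Lemma adjoin_sub P z : P `<=` adjoin P z.
Proof. by move=> x Px W _ PW _; exact: PW. Qed.

Lemma adjoin_mem P z : adjoin P z z.
Proof. by []. Qed.

Lemma adjoin_least P z W : open_subgroup W -> P `<=` W -> W z ->
  adjoin P z `<=` W.
Proof. by move=> oW PW Wz x; apply. Qed.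

Lemma adjoin_mono P P' z : P `<=` P' -> adjoin P z `<=` adjoin P' z.
Proof. by move=> PP' x Px W oW P'W Wz; apply: Px => // y /PP'/P'W. Qed.

Lemma adjoin_subgroup P z : is_subgroup (adjoin P z).
Proof.
apply/is_subgroupP; split.
- by move=> W [gW _] _ _; exact: (subgroup1 gW).
- by move=> a b Pa Pb W oW PW Wz; apply: (subgroupM oW.1); [exact: Pa|exact: Pb].
- by move=> a Pa W oW PW Wz; apply: (subgroupV oW.1); exact: Pa.
Qed.

Lemma adjoin_closed P z : closed (adjoin P z).
Proof.
move=> x cx W oW PW Wz; apply: (open_subgroup_closed oW) => O /cx[y [Py Oy]].
by exists y; split => //; exact: Py.
Qed.

(** Closed subgroups of infinite index. *)
Definition closed_nonopen P := [/\ is_subgroup P, closed P & ~ open P].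

Definition decided P z := P z \/ open_subgroup (adjoin P z).

Lemma decided_mono P P' z : P `<=` P' -> decided P z -> decided P' z.
Proof.
move=> PP' [/PP'|oP]; first by left.
right; apply: (open_subgroupS (adjoin_subgroup P' z) oP).
exact: adjoin_mono.
Qed.

(** Greedy choice: [z] is adjoined whenever this does not create an open subgroup,
    and a decision once taken persists in larger subgroups. *)
Lemma decide_seq (s : seq F) P U : closed_nonopen P -> open_subgroup U ->
  P `<=` U -> (forall z, z \in s -> U z) ->
  exists P', [/\ closed_nonopen P', P `<=` P', P' `<=` U &
    forall z, z \in s -> decided P' z].
Proof.
elim: s P => [|z s IH] P nP oU PU sU; first by exists P; split.
have Uz : U z by apply: sU; rewrite inE eqxx.
have sU' x : x \in s -> U x by move=> xs; apply: sU; rewrite inE xs orbT.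
have [oA|nA] := pselect (open (adjoin P z)).
  have [P' [nP' PP' P'U sP']] := IH P nP oU PU sU'.
  exists P'; split => // x; rewrite inE => /orP[/eqP->|/sP'//].
  apply: (decided_mono PP'); right; split=> //; exact: adjoin_subgroup.
have [||P' [nP' PP' P'U sP']] := IH (adjoin P z) _ oU _ sU'.
- by split => //; [exact: adjoin_subgroup|exact: adjoin_closed].
- exact: adjoin_least.
exists P'; split => //; first exact: (subset_trans (adjoin_sub (z := z))).
move=> x; rewrite inE => /orP[/eqP->|/sP'//].
by left; apply: PP'; exact: adjoin_mem.
Qed.

(** One step of the construction: a closed subgroup [st_P] of infinite index inside
    the open subgroup [st_U], which has the finite basis [st_y]. *)
Record stage := Stage {
  st_P : set F ; st_U : set F ; st_I : finType ; st_y : st_I -> F }.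

Definition stage_ok st := [/\ closed_nonopen (st_P st), open_subgroup (st_U st),
  st_P st `<=` st_U st, free_basis (st_U st) (@st_y st) & (1 < #|st_I st|)%N].

Definition stage_next st st' := [/\ st_P st `<=` st_P st',
  st_U st' `<=` st_U st, (#|st_I st| < #|st_I st'|)%N &
  forall i j, decided (st_P st') (@st_y st i * (@st_y st j)^-1)].

Lemma stage_step st : stage_ok st ->
  exists st', stage_ok st' /\ stage_next st st'.
Proof.
case: st => P U I y [/= nP oU PU yb I1].
pose s := [seq y ij.1 * (y ij.2)^-1 | ij <- enum {: I * I}].
have [Uy _ _] := yb.
have [|P' [nP' PP' P'U sP']] := decide_seq (s := s) nP oU PU.
  move=> z /mapP[[i j] _ ->] /=.
  by apply: (subgroupM oU.1) => //; apply: (subgroupV oU.1).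
have [gP' cP' oP'] := nP'.
have [x [Ux nP'x]] : exists x, U x /\ ~ P' x.
  apply: contrapT => h; apply: oP'; suff -> : P' = U by exact: oU.2.
  apply/seteqP; split => // x Ux; apply: contrapT => nx; apply: h; by exists x.
have [W [oW P'W nWx]] := closed_subgroup_separation Fpro gP' cP' nP'x.
have oV := open_subgroupI oU oW.
have [|J [z [zb _ IJ _]]] := nielsen_schreier Fpro oU oV _ yb.
  by move=> ? [].
have {}IJ : (#|I| < #|J|)%N.
  by apply: IJ => // /(_ x Ux) [].
exists (@Stage P' (U `&` W) J z).
split; split => //.
- by move=> a P'a; split; [exact: P'U|exact: P'W].
- exact: ltn_trans IJ.
- by move=> a [].
- by move=> i j; apply: sP'; apply/mapP; exists (i, j); rewrite ?mem_enum.
Qed.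

(** What the solution of embedding problems needs: arbitrarily close to [L], open
    subgroups with arbitrarily large bases. *)
Definition rich L := forall U (n : nat), open_subgroup U -> L `<=` U ->
  exists (V : set F) (I : finType) (y : I -> F),
  [/\ open_subgroup V, L `<=` V /\ V `<=` U, free_basis V y, (n <= #|I|)%N &
      forall i j, decided L (y i * (y j)^-1)].

(** [L] is the intersection of the open subgroups of a chain of stages; it contains
    all the closed subgroups of the chain. Nothing prevents the closure of the
    union of these from being open, which is why the upper bounds are needed. *)
Lemma rich_exists (I : finType) (y : I -> F) H : free_basis setT y ->
  (1 < #|I|)%N -> closed_nonopen H ->
  exists L, [/\ is_subgroup L, closed L, H `<=` L & rich L].
Proof.
move=> yb I1 nH.
pose T := {st | stage_ok st}.
have st0P : stage_ok (@Stage H setT I y) by split => //; exact: open_subgroupT.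
have stepP (st : T) : exists st' : T, stage_next (sval st) (sval st').
  by have [st' [ok nxt]] := stage_step (svalP st); exists (exist _ st' ok).
have [nxt nxtP] := choice stepP.
pose st n := iter n nxt (exist _ _ st0P : T).
pose P n := st_P (sval (st n)); pose U n := st_U (sval (st n)).
have next n : stage_next (sval (st n)) (sval (st n.+1)) by exact: nxtP.
have okU n : open_subgroup (U n) by rewrite /U; case: (svalP (st n)).
have PU n : P n `<=` U n by rewrite /P /U; case: (svalP (st n)).
have Pmono m n : (m <= n)%N -> P m `<=` P n.
  move=> /subnK <-; elim: (n - m)%N => [//|k IH].
  by apply: subset_trans IH _; case: (next (k + m)%N).
have Umono m n : (m <= n)%N -> U n `<=` U m.
  move=> /subnK <-; elim: (n - m)%N => [//|k IH].
  by apply: subset_trans _ IH; case: (next (k + m)%N).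
have cardI n : (n <= #|st_I (sval (st n))|)%N.
  by elim: n => // n IH; case: (next n) => _ _ /(leq_ltn_trans IH).
pose L := \bigcap_n U n.
have PL n : P n `<=` L.
  move=> x Px m _; have [mn|/ltnW nm] := leqP m n; last first.
    by apply: PU; exact: (Pmono _ _ nm).
  by apply: (Umono _ _ mn); exact: PU.
exists L; split.
- by apply: subgroup_bigcap => n _; exact: (okU n).1.
- by apply: closed_bigI => n _; exact: open_subgroup_closed.
- exact: (PL 0%N).
move=> W n oW LW.
(* By compactness, as the intersection L of the U m lies in W. *)
have [m UW] : exists m, U m `<=` W.
  apply: contrapT => noU; have [Fc _ _] := Fpro.
  have [|||x Ax] := @compact_nested F (fun n => U n `&` ~` W) Fc.
  - move=> k; apply: closedI; first exact: open_subgroup_closed.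
    exact: (open_closedC oW.2).
  - move=> k; apply: contrapT => UW0; apply: noU; exists k => x Ux.
    by apply: contrapT => nWx; apply: UW0; exists x.
  - by move=> k x [Ux nW]; split => //; exact: (Umono _ _ (leqnSn k)).
  - by case: (Ax 0%N) => _; apply; apply: LW => k _; by case: (Ax k).
pose k := maxn m n.
have [_ _ _ kb _] := svalP (st k); have [_ _ _ dec] := next k.
exists (U k), (st_I (sval (st k))), (@st_y (sval (st k))); split => //.
- split; first by move=> x /(_ k Logic.I).
  by apply: subset_trans UW; apply: Umono; exact: leq_maxl.
- exact: leq_trans (leq_maxr m n) (cardI k).
- by move=> i j; apply: decided_mono (dec i j); exact: PL.
Qed.

End Chain.

(** * Finite embedding problems *)

Section Embedding.
Variable F : topologicalGroupType.
Hypothesis Fpro : profinite F.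
Implicit Types (P U W N L : set F).

(** With [N] open normal and [f] trivial on the intersection of [L] and [N], put
    [f' (l n) = f l] on the open subgroup [L N]; the image does not grow. *)
Lemma hom_extension L (K : finGroupType) (f : F -> K) : is_subgroup L ->
  hom_on L f -> exists U f', [/\ open_subgroup U, L `<=` U, hom_on U f',
    forall x, L x -> f' x = f x & forall x, U x -> exists2 l, L l & f' x = f l].
Proof.
move=> gL hf; have [fM [N0 [oN0 fN0]]] := hf.
have [N [oN NN0 nN]] := open_normal_core Fpro oN0.
have gN := oN.1.
have fN x : L x -> N x -> f x = 1 by move=> Lx /NN0; exact: fN0.
have oU := open_subgroup_mul gL oN nN.
set U : set F := [set x | exists2 l, L l & N (l^-1 * x)] in oU.
have : forall x, exists l, U x -> L l /\ N (l^-1 * x).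
  by move=> x; have [[l]|nU] := pselect (U x); [exists l|exists 1].
move=> /choice[r rP].
have fE x l : L l -> N (l^-1 * x) -> f (r x) = f l.
  move=> Ll Nlx; have [|Lr Nr] := rP x; first by exists l.
  have : f ((r x)^-1 * l) = 1.
    apply: fN; first by apply: (subgroupM gL) => //; exact: (subgroupV gL).
    have := subgroupM gN Nr (subgroupV gN Nlx).
    by rewrite invgM invgK mulgA mulgK.
  rewrite (hom_onM hf) ?(hom_onV gL hf)//; last exact: (subgroupV gL).
  by move/(canRL (mulKg _)); rewrite invgK mulg1.
have UM x y l k : L l -> N (l^-1 * x) -> L k -> N (k^-1 * y) ->
    N ((l * k)^-1 * (x * y)).
  move=> Ll Nx Lk Ny; have := subgroupM gN (nN k^-1 _ Nx) Ny.
  by rewrite invgK invgM !mulgA mulgK.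
exists U, (f \o r); split => //.
- by move=> x Lx; exists x => //; rewrite mulVg; exact: (subgroup1 gN).
- split.
    move=> x y /rP[Lx Nx] /rP[Ly Ny] /=.
    rewrite (@fE (x * y) (r x * r y)) ?(hom_onM hf)//; last exact: UM.
    exact: (subgroupM gL).
  exists N; split => // x _ Nx /=.
  rewrite (@fE x 1) ?invg1 ?mul1g ?(hom_on1 gL hf)//; exact: (subgroup1 gL).
- move=> x Lx /=; apply: fE => //; rewrite mulVg; exact: (subgroup1 gN).
- by move=> x /rP[Lr _]; exists (r x).
Qed.

Lemma pigeonhole (I J : finType) (f : I -> J) m : (#|J| * m < #|I|)%N ->
  exists a, (m < #|[set i | f i == a]%SET|)%N.
Proof.
move=> big; apply: contrapT => small; move: big; apply/negP; rewrite -leqNgt.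
rewrite -sum1_card (partition_big f predT)//= -sum_nat_const.
apply: leq_sum => a _; rewrite sum1_card leqNgt; apply/negP => h.
by apply: small; exists a; rewrite cardsE (eq_card (B := (fun i => f i == a))).
Qed.

Lemma cover_onto (I T : finType) (A : {set I}) (S : {set T}) s0 :
  s0 \in S -> (#|S| <= #|A|)%N ->
  exists b : I -> T, (forall i, b i \in S) /\
    forall s, s \in S -> exists2 i, i \in A & b i = s.
Proof.
move=> s0S SA; pose b i := nth s0 (enum S) (index i (enum A)).
exists b; split.
  move=> i; rewrite /b; case: (ltnP (index i (enum A)) (size (enum S))) => h.
    by rewrite -mem_enum mem_nth.
  by rewrite nth_default.
move=> s sS; have sE : s \in enum S by rewrite mem_enum.
have A0 : (index s (enum S) < size (enum A))%N.
  by rewrite -cardE; apply: leq_trans SA; rewrite cardE index_mem.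
have [i0 _] : exists i, i \in A by apply/card_gt0P; rewrite cardE;
  apply: leq_trans A0.
exists (nth i0 (enum A) (index s (enum S))).
  by rewrite -mem_enum mem_nth.
by rewrite /b index_uniq ?enum_uniq// nth_index.
Qed.

Section Lift.
Variables (K K' : finGroupType) (B : {group K}) (p : K -> K').
Hypothesis pM : {in B &, {morph p : a b / a * b}}.

(** When the basis elements indexed by [A] have the same image under [f] and are
    numerous enough, they can be sent onto a whole fibre of [p], so that their
    quotients reach every element of the kernel of [p]. The other basis elements
    have prescribed lifts [b0]. *)
Lemma lift_onto U (I : finType) (y : I -> F) (f : F -> K')
    (b0 : I -> K) (A : {set I}) i0 :
  open_subgroup U -> free_basis U y -> hom_on U f ->
  (forall i, b0 i \in B) -> (forall i, p (b0 i) = f (y i)) ->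
  i0 \in A -> (forall i, i \in A -> f (y i) = f (y i0)) -> (#|K| <= #|A|)%N ->
  exists g, [/\ hom_on U g, forall x, U x -> g x \in B,
    forall x, U x -> p (g x) = f x, forall i, i \notin A -> g (y i) = b0 i &
    forall k, k \in B -> p k = 1 -> exists2 i, i \in A & g (y i * (y i0)^-1) = k].
Proof.
move=> oU yb hf b0B pb0 i0A fA KA; have gU := oU.1; have [Uy _ _] := yb.
pose S := [set k in B | p k == f (y i0)]%SET.
have SA : (#|S| <= #|A|)%N by apply: leq_trans KA; exact: max_card.
have b0S : b0 i0 \in S by rewrite inE b0B pb0 eqxx.
have [b [bS bonto]] := cover_onto b0S SA.
pose c i := if i \in A then b i else b0 i.
have bP i : b i \in B /\ p (b i) = f (y i0).
  by have := bS i; rewrite inE => /andP[? /eqP].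
have [||g [hg gB pg gc]] := free_basis_lift (b := c) oU yb hf pM.
- by move=> i; rewrite /c; case: ifP => // _; case: (bP i).
- move=> i; rewrite /c; case: ifP => // iA; first by rewrite fA//; case: (bP i).
exists g; split => //.
  by move=> i /negbTE iA; rewrite gc /c iA.
move=> k kB pk1; have [|i iA bi] := bonto (k * g (y i0)).
  have gi0 : g (y i0) \in B by exact: gB.
  by rewrite inE groupM// pM// pk1 mul1g pg//=.
exists i => //; rewrite (hom_onM hg)//; last exact: (subgroupV gU).
by rewrite (hom_onV gU hg)// gc {1}/c iA bi mulgK.
Qed.

Lemma onto_of_kernel L (f : F -> K') (g : F -> K) :
  is_subgroup L -> hom_on L g -> (forall x, L x -> g x \in B) ->
  (forall x, L x -> p (g x) = f x) ->
  (forall b, b \in B -> exists2 x, L x & f x = p b) ->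
  (forall k, k \in B -> p k = 1 -> exists2 x, L x & g x = k) ->
  forall b, b \in B -> exists2 x, L x & g x = b.
Proof.
move=> gL hg gB pg fonto ker b bB; have [x Lx fx] := fonto b bB.
have p1 : p 1 = 1.
  by apply: (mulgI (p 1)); rewrite -pM ?group1// mulg1 [RHS]mulg1.
have pV a : a \in B -> p a^-1 = (p a)^-1.
  by move=> aB; apply: (mulgI (p a)); rewrite -pM ?groupV// !mulgV.
have [||z Lz gz] := ker (b * (g x)^-1).
- by rewrite groupM// groupV gB.
- by rewrite pM ?groupV ?gB// pV ?gB// pg// fx mulgV.
exists (z * x); first exact: (subgroupM gL).
by rewrite (hom_onM hg)// gz mulgKV.
Qed.

Lemma replace_basis U (I : finType) (y : I -> F) (i0 j : I) :
  open_subgroup U -> free_basis U y -> i0 != j ->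
  free_basis U (fun i => if i == j then y j * (y i0)^-1 else y i).
Proof.
move=> oU [Uy gen univ] ne; have gU := oU.1; split.
- move=> i; case: ifP => // _; apply: (subgroupM gU) => //.
  exact: (subgroupV gU).
- move=> W oW Wy; apply: gen => // i; have gW := oW.1.
  have := Wy i; case: eqP => // ->.
  have := Wy i0; rewrite (negbTE ne) => Wi0 Wj.
  by have := subgroupM gW Wj Wi0; rewrite mulgKV.
- move=> K1 a; have [g [hg ga]] := univ K1
    (fun i => if i == j then a j * a i0 else a i).
  exists g; split => // i; case: eqP => [->|/eqP/negbTE ij].
    rewrite (hom_onM hg)//; last exact: (subgroupV gU).
    by rewrite (hom_onV gU hg)// !ga eqxx (negbTE ne) mulgK.
  by rewrite ga ij.
Qed.

(** The core of the proof. The bound [#|K'| * #|K|.+1] gives, by the pigeonhole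
    principle, more than [#|K|.+1] basis elements with the same image; the second
    time, one of them may be [z], whose lift is forced to be 1, and more than
    [#|K|] remain. *)
Lemma rich_embedding L (f : F -> K') : is_subgroup L -> rich L ->
  hom_on L f ->
  (forall b, b \in B -> exists2 x, L x & f x = p b) ->
  (forall x, L x -> exists2 b, b \in B & p b = f x) ->
  exists g, [/\ hom_on L g, forall x, L x -> g x \in B,
    forall x, L x -> p (g x) = f x &
    forall b, b \in B -> exists2 x, L x & g x = b].
Proof.
move=> gL rL hf fonto fB.
have [U0 [f' [oU0 LU0 hf' f'E f'L]]] := hom_extension gL hf.
have [U [I [y [oU [LU UU0] yb cI dec]]]] :=
  rL U0 (#|K'| * #|K|.+1).+1 oU0 LU0.
have hfU := hom_onS UU0 hf'.
have gU := oU.1; have [Uy _ _] := yb.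
have f'B x : U x -> exists2 b, b \in B & p b = f' x.
  by move=> /UU0/f'L[l /fB[b bB pb] ->]; exists b.
have : forall i, exists b, b \in B /\ p b = f' (y i).
  by move=> i; have [b ? ?] := f'B _ (Uy i); exists b.
move=> /choice[b0 b0P].
have [a cA] := pigeonhole (fun i => f' (y i)) cI.
set A := [set i | f' (y i) == a]%SET in cA.
have [i0 i0A] : exists i, i \in A by apply/card_gt0P; apply: leq_trans cA.
have fA i : i \in A -> f' (y i) = f' (y i0).
  by move: i0A; rewrite !inE => /eqP -> /eqP.
(* Either all quotients of the chosen basis elements lie in L, and a lift
   to U sends them onto the kernel; or one of them, z, does not. *)
have [allL|] := pselect (forall i, i \in A -> L (y i * (y i0)^-1)).
  have [|||g [hg gB pg _ gonto]] := lift_onto (b0 := b0) oU yb hfU _ _ i0A fA.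
  - by move=> i; case: (b0P i).
  - by move=> i; case: (b0P i).
  - exact: ltnW (ltnW cA).
  have hgL := hom_onS LU hg.
  exists g; split => //; first by move=> x /LU; exact: gB.
    by move=> x Lx; rewrite pg ?f'E//; exact: LU.
  apply: (onto_of_kernel (f := f) gL hgL) => //.
  - by move=> x /LU; exact: gB.
  - by move=> x Lx; rewrite pg ?f'E//; exact: LU.
  - move=> k kB /(gonto k kB)[i iA <-].
    by exists (y i * (y i0)^-1) => //; exact: allL.
move=> /existsNP[j /not_implyP[jA nLz]].
set z := y j * (y i0)^-1 in nLz.
have ne : i0 != j.
  by apply/eqP => e; apply: nLz; rewrite /z e mulgV; exact: (subgroup1 gL).
have [//|oV] := dec j i0; rewrite -/z in oV.
set V := adjoin L z in oV; have gV := oV.1.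
have LV : L `<=` V by exact: adjoin_sub.
have Vz : V z by [].
have Uz : U z by apply: (subgroupM gU) => //; exact: (subgroupV gU).
have VU : V `<=` U by apply: adjoin_least.
(* z belongs to a basis of U, hence to a basis w of V = <L, z>. *)
have y'b := replace_basis oU yb ne.
have [J [w [wb IJ _ wz]]] := nielsen_schreier Fpro oU oV VU y'b.
have [k wk] : exists k, w k = z.
  by have := wz j; rewrite eqxx; exact.
have [Vw _ _] := wb.
have hfV := hom_onS VU hfU.
have f'z : f' z = 1.
  rewrite (hom_onM hfU)//; last exact: (subgroupV gU).
  by rewrite (hom_onV gU hfU)// (fA _ jA) mulgV.
have p1 : p 1 = 1.
  by apply: (mulgI (p 1)); rewrite -pM ?group1// mulg1 [RHS]mulg1.
have : forall i, exists b, [/\ b \in B, p b = f' (w i) & w i = z -> b = 1].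
  move=> i; have [->|nz] := pselect (w i = z); first by exists 1; rewrite group1 p1.
  by have [b ? ?] := f'B _ (VU _ (Vw i)); exists b.
move=> /choice[b1 b1P].
have [a1 cA1] := pigeonhole (fun i => f' (w i)) (leq_trans cI IJ).
set A1 := [set i | f' (w i) == a1]%SET in cA1.
pose A2 := (A1 :\ k)%SET.
have cA2 : (#|K| < #|A2|)%N.
  by move: cA1; rewrite (cardsD1 k A1) -/A2; case: (k \in A1) => /=; lia.
have [i1 i1A] : exists i, i \in A2 by apply/card_gt0P; apply: leq_trans cA2.
have fA2 i : i \in A2 -> f' (w i) = f' (w i1).
  by move: i1A; rewrite !inE => /andP[_ /eqP ->] /andP[_ /eqP].
have [|||g [hg gB pg gb1 gonto]] := lift_onto (b0 := b1) oV wb hfV _ _ i1A fA2.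
- by move=> i; case: (b1P i).
- by move=> i; case: (b1P i).
- exact: ltnW cA2.
have gz : g z = 1.
  by rewrite -wk gb1 ?inE ?eqxx//; case: (b1P k) => _ _; exact.
have hgL := hom_onS LV hg.
(* As g z = 1, the elements of V with the same image as some element of
   L form an open subgroup containing L and z, that is, all of V. *)
pose W : set F := V `&` [set x | exists2 l, L l & g l = g x].
have gW : is_subgroup W.
  apply/is_subgroupP; split.
  - split; first exact: (subgroup1 gV).
    by exists 1 => //; exact: (subgroup1 gL).
  - move=> x x' [Vx [l Ll e]] [Vx' [l' Ll' e']]; split; first exact: (subgroupM gV).
    exists (l * l'); first exact: (subgroupM gL).
    by rewrite (hom_onM hgL)// (hom_onM hg)// e e'.
  - move=> x [Vx [l Ll e]]; split; first exact: (subgroupV gV).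
    exists l^-1; first exact: (subgroupV gL).
    by rewrite (hom_onV gL hgL)// (hom_onV gV hg)// e.
have oW : open_subgroup W.
  apply: (hom_on_open oV hg gW) => x Vx gx; split => //.
  by exists 1; [exact: (subgroup1 gL)|rewrite gx (hom_on1 gV hg)].
have VW : V `<=` W.
  apply: adjoin_least => //.
    by move=> x Lx; split; [exact: LV|exists x].
  split => //; exists 1; first exact: (subgroup1 gL).
  by rewrite gz (hom_on1 gV hg).
exists g; split => //; first by move=> x /LV; exact: gB.
  by move=> x Lx; rewrite pg ?f'E//; exact: LV.
apply: (onto_of_kernel (f := f) gL hgL) => //.
- by move=> x /LV; exact: gB.
- by move=> x Lx; rewrite pg ?f'E//; exact: LV.
- move=> b bB /(gonto b bB)[i iA <-].
  suff [_ [l Ll gl]] : W (w i * (w i1)^-1) by exists l.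
  apply: VW; apply: (subgroupM gV) => //; exact: (subgroupV gV).
Qed.

End Lift.
End Embedding.

(** * Countably many finite quotients *)

(** Up to isomorphism the finite groups are subgroups of the symmetric groups on
    ['I_n], which makes the data used below countable. *)
Lemma cayley (K : finGroupType) : exists (n : nat) (e : K -> {perm 'I_n}),
  injective e /\ {morph e : a b / a * b}.
Proof.
pose q (k : K) (i : 'I_#|K|) : 'I_#|K| := enum_rank (enum_val i * k).
have q_inj k : injective (q k).
  by move=> i j /enum_rank_inj/mulIg/enum_val_inj.
exists #|K|, (fun k => perm (q_inj k)); split.
  move=> a b /permP/(_ (enum_rank 1)); rewrite !permE /q enum_rankK !mul1g.
  exact: enum_rank_inj.
by move=> a b; apply/permP => i; rewrite permM !permE /q enum_rankK mulgA.
Qed.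

Section Cofinal.
Variable F : topologicalGroupType.
Hypothesis Fpro : profinite F.

Lemma open_subgroup_kernel (W : set F) : open_subgroup W ->
  exists n (f : F -> {perm 'I_n}), hom_on setT f /\ forall x, f x = 1 -> W x.
Proof.
move=> oW; have oT := @open_subgroupT F.
have [C [cl [rep csys]]] := coset_system_exists Fpro oT.1 oW.
have [n [e [e_inj eM]]] := cayley {perm C}.
have q_inj u := coset_act_inj oT csys (u := u) I.
pose f u := perm (q_inj u).
have fM u v : f (u * v) = f u * f v.
  apply/permP => c; rewrite permM !permE.
  exact: (coset_actM oT csys).
have [_ _ clP] := csys.
exists n, (e \o f); split.
  apply: (@hom_on_comp _ _ _ _ f finset.setT _ oT.1) => //.
    split; first by move=> x y _ _; exact: fM.
    have [N [oN _ Nfix]] := coset_kernel_open oT oW csys.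
    exists N; split => // u _ Nu; apply/permP => c.
    by rewrite permE perm1 Nfix.
  by move=> x y _ _; exact: eM.
move=> x /= ef1; have : f x = 1.
  have e1 : e 1 = 1 by apply: (mulgI (e 1)); rewrite -eM mulg1 [RHS]mulg1.
  by apply: e_inj; rewrite ef1 e1.
move=> /permP/(_ (cl 1)); rewrite permE perm1 (coset_act_base oT csys)//.
by move=> /(clP x 1 I I); rewrite invg1 mulg1.
Qed.

(** Homomorphisms from [F] to ['S_n] are determined by their values on the finite
    basis, so there are countably many of them. *)
Lemma cofinal_homs (I : finType) (y : I -> F) : free_basis setT y ->
  exists (d : nat -> nat) (h : forall m, F -> {perm 'I_(d m)}),
  (forall m, hom_on setT (h m)) /\
  forall W, open_subgroup W -> exists m, forall x, h m x = 1 -> W x.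
Proof.
move=> yb; have [_ _ univ] := yb.
pose T : countType := {n : nat & {ffun I -> {perm 'I_n}}}.
have : forall t : T, exists g : F -> {perm 'I_(tag t)},
    hom_on setT g /\ forall i, g (y i) = tagged t i.
  by move=> t; exact: univ.
move=> gP; pose g t := sval (cid (gP t)).
have g_spec t : hom_on setT (g t) /\ forall i, g t (y i) = tagged t i.
  exact: (svalP (cid (gP t))).
pose t0 : T := Tagged (fun n => {ffun I -> {perm 'I_n}}) [ffun=> 1 : {perm 'I_0}].
pose t m : T := odflt t0 (choice.unpickle m).
exists (fun m => tag (t m)), (fun m => g (t m)); split.
  by move=> m; case: (g_spec (t m)).
move=> W oW; have [n [f [hf fW]]] := open_subgroup_kernel oW.
pose tf : T := Tagged (fun n => {ffun I -> {perm 'I_n}}) [ffun i => f (y i)].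
exists (choice.pickle tf) => x; rewrite /t choice.pickleK /= => gx; apply: fW.
have [hg gy] := g_spec tf.
rewrite -(free_basis_hom_eq (@open_subgroupT F) yb hg hf) // => i.
by rewrite gy ffunE.
Qed.

End Cofinal.

(** * Iwasawa's criterion *)

Section Iwasawa.
Variable F : topologicalGroupType.
Hypothesis Fpro : profinite F.
Variable L : set F.
Hypotheses (gL : is_subgroup L) (cL : closed L).

Lemma hom_on_pair (K K' : finGroupType) (f : F -> K) (g : F -> K') :
  hom_on L f -> hom_on L g ->
  hom_on L (fun x => (f x, g x)).
Proof.
move=> [fM [N [oN fN]]] [gM [N' [oN' gN]]]; split.
  by move=> x y Lx Ly; rewrite fM// gM.
exists (N `&` N'); split; first exact: open_subgroupI.
by move=> x Lx [Nx N'x]; rewrite fN// gN.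
Qed.

Definition hom_image (K : finGroupType) (f : F -> K) : {set K} :=
  [set a | `[< exists2 x, L x & f x = a >]]%SET.

Lemma hom_imageP (K : finGroupType) (f : F -> K) a :
  reflect (exists2 x, L x & f x = a) (a \in hom_image f).
Proof. by rewrite inE; exact: asboolP. Qed.

Lemma hom_image_group (K : finGroupType) (f : F -> K) : hom_on L f ->
  group_set (hom_image f).
Proof.
move=> hf; apply/group_setP; split.
  apply/hom_imageP; exists 1; [exact: (subgroup1 gL)|exact: (hom_on1 gL hf)].
move=> a b /hom_imageP[x Lx <-] /hom_imageP[z Lz <-].
apply/hom_imageP; exists (x * z); first exact: (subgroupM gL).
exact: (hom_onM hf).
Qed.

(** A finite quotient of [L], together with a sequence in [L], trivial from [mk_k]
    on, whose first [mk_k] terms generate the quotient: a finite approximation of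
    a basis converging to 1. *)
Record marking := Marking { mk_K : finGroupType; mk_f : F -> mk_K ;
  mk_k : nat ; mk_s : nat -> F }.

Definition marks M : {set mk_K M} :=
  [set mk_f M (mk_s M (val j)) | j : 'I_(mk_k M)]%SET.

Definition marking_ok M := [/\ hom_on L (mk_f M), forall j, L (mk_s M j),
  forall j, (mk_k M <= j)%N -> mk_s M j = 1 &
  forall x, L x -> mk_f M x \in <<marks M>>].

Definition finer (K K' : finGroupType) (f : F -> K) (f' : F -> K') :=
  forall x, L x -> f x = 1 -> f' x = 1.

Lemma finer_eq (K K' : finGroupType) (f : F -> K) (f' : F -> K') x y :
  hom_on L f -> hom_on L f' -> finer f f' -> L x -> L y -> f x = f y -> f' x = f' y.
Proof.
move=> hf hf' ff' Lx Ly e; have LyV := subgroupV gL Ly.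
have : f' (x * y^-1) = 1.
  apply: ff'; first exact: (subgroupM gL).
  by rewrite (hom_onM hf)// (hom_onV gL hf)// e mulgV.
rewrite (hom_onM hf')// (hom_onV gL hf')// => /(canRL (mulgKV _)).
by rewrite mul1g.
Qed.

(** A refinement may only modify the sequence within the kernel of the coarser
    quotient; in particular the new terms lie in this kernel, which is what makes
    the limit sequence converge to 1. *)
Definition marking_ext M M' := [/\ finer (mk_f M') (mk_f M),
  (mk_k M <= mk_k M')%N & forall j, mk_f M (mk_s M' j) = mk_f M (mk_s M j)].

Hypothesis embed : forall (K K' : finGroupType) (B : {group K}) (p : K -> K')
    (f : F -> K'),
  {in B &, {morph p : a b / a * b}} -> hom_on L f ->
  (forall b, b \in B -> exists2 x, L x & f x = p b) ->
  (forall x, L x -> exists2 b, b \in B & p b = f x) ->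
  exists g, [/\ hom_on L g, forall x, L x -> g x \in B,
    forall x, L x -> p (g x) = f x &
    forall b, b \in B -> exists2 x, L x & g x = b].

(** To make room for a homomorphism [g] with prescribed values [a j], take the
    subgroup [B] of [mk_K M * K] generated by the pairs [(f (s j), a j)]; a
    surjective solution of the embedding problem [B -> mk_K M] yields both the
    refined quotient [B] and, as second projection, [g]. *)
Lemma marking_forth M (K : finGroupType) (a : nat -> K) m : marking_ok M ->
  (forall j, (m <= j)%N -> a j = 1) ->
  exists M' (g : F -> K), [/\ marking_ok M', marking_ext M M', hom_on L g,
    finer (mk_f M') g & forall j, g (mk_s M' j) = a j].
Proof.
case: M => A f k s [/= hf Ls s1 fgen] a1.
pose k1 := maxn k m.
pose X : {set A * K} := [set (f (s (val j)), a (val j)) | j : 'I_k1]%SET.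
pose B : {group A * K} := <<X>>%G.
have fstM : {in B &, {morph (fst : A * K -> A) : b c / b * c}} by [].
have sndM : {in B &, {morph (snd : A * K -> K) : b c / b * c}} by [].
have XB j : (j < k1)%N -> (f (s j), a j) \in B.
  by move=> jk; apply: mem_gen; apply/imsetP; exists (Ordinal jk).
pose fL := Group (hom_image_group hf).
have BfL b : b \in B -> exists2 x, L x & f x = b.1.
  have : B \subset (fst_morphism A K @*^-1 fL)%G.
    rewrite gen_subG; apply/fintype.subsetP => _ /imsetP[j _ ->].
    apply/morphpreP; split; first by rewrite finset.in_setT.
    by apply/hom_imageP; exists (s (val j)).
  by move=> /fintype.subsetP h /h /morphpreP[_ /hom_imageP].
have fLB x : L x -> exists2 b, b \in B & b.1 = f x.
  move=> Lx; have := fgen x Lx.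
  have : <<marks (Marking f k s)>> \subset fst_morphism A K @* B.
    rewrite gen_subG; apply/fintype.subsetP => _ /imsetP[j _ ->] /=.
    have jk : (val j < k1)%N by apply: leq_trans (ltn_ord j) (leq_maxl _ _).
    by apply/morphimP; exists (f (s (val j)), a (val j)); rewrite ?inE ?XB.
  move=> /fintype.subsetP h /h /morphimP[b _ bB ->]; by exists b.
have [g [hg gB pg gonto]] := embed fstM hf BfL fLB.
have : forall j, exists x, [/\ L x, (j < k1)%N -> g x = (f (s j), a j) &
    (k1 <= j)%N -> x = 1].
  move=> j; case: (ltnP j k1) => jk.
    by have [x Lx gx] := gonto _ (XB j jk); exists x.
  by exists 1; split => //; exact: (subgroup1 gL).
move=> /choice[s' s'P].
have Ls' j : L (s' j) by case: (s'P j).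
have s'1 j : (k1 <= j)%N -> s' j = 1 by case: (s'P j).
have gs' j : g (s' j) = (f (s j), a j).
  case: (ltnP j k1) => jk; first by case: (s'P j) => _ /(_ jk).
  rewrite s'1// (hom_on1 gL hg) s1 ?a1 ?(hom_on1 gL hf)//.
    by apply: leq_trans jk; exact: leq_maxr.
  by apply: leq_trans jk; exact: leq_maxl.
exists (Marking g k1 s'), (snd \o g); split.
- split => //.
  move=> x Lx; suff -> : marks (Marking g k1 s') = X by exact: gB.
  by apply: eq_imset => j /=; rewrite gs'.
- split => /=.
  + by move=> x Lx gx; rewrite -pg// gx.
  + exact: leq_maxl.
  + by move=> j; rewrite -pg// gs'.
- exact: (hom_on_comp gL hg gB sndM).
- by move=> x Lx /= ->.
- by move=> j /=; rewrite gs'.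
Qed.

(** The quotient is refined by [h] without constraint on the sequence: keep the old
    terms, and append representatives of all the elements of the new quotient
    that are trivial in the old one. *)
Lemma marking_back M (K : finGroupType) (h : F -> K) : marking_ok M ->
  hom_on L h -> exists M', [/\ marking_ok M', marking_ext M M' &
    finer (mk_f M') h].
Proof.
case: M => A f k s [/= hf Ls s1 fgen] hh.
pose f2 x := (f x, h x).
have hf2 : hom_on L f2 := hom_on_pair hf hh.
have : forall c, exists x, [/\ L x, f x = 1 &
    (exists x', [/\ L x', f x' = 1 & h x' = c]) -> h x = c].
  move=> c; have [[x [Lx fx hx]]|no] :=
      pselect (exists x', [/\ L x', f x' = 1 & h x' = c]).
    by exists x.
  by exists 1; rewrite (hom_on1 gL hf); split => //; exact: (subgroup1 gL).
move=> /choice[r rP].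
pose k2 := (k + #|K|)%N.
pose s2 j := if (j < k)%N then s j else
  if (j < k2)%N then r (nth 1 (enum K) (j - k)) else 1.
have fs2 j : f (s2 j) = f (s j).
  rewrite /s2; case: ltnP => // kj; rewrite (s1 _ kj) (hom_on1 gL hf).
  by case: ifP => _; [case: (rP (nth 1 (enum K) (j - k)))|exact: (hom_on1 gL hf)].
have Ls2 j : L (s2 j).
  rewrite /s2; case: ifP => // _; case: ifP => _; last exact: (subgroup1 gL).
  by case: (rP (nth 1 (enum K) (j - k))).
pose M' := Marking f2 k2 s2.
have mM' j : (j < k2)%N -> f2 (s2 j) \in <<marks M'>>.
  by move=> jk; apply: mem_gen; apply/imsetP; exists (Ordinal jk).
exists M'; split; [split => //=|split => //=|].
- by move=> j kj; rewrite /s2 !ltnNge kj (leq_trans (leq_addr _ _) kj).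
- move=> x Lx; have := fgen x Lx.
  have : <<marks (Marking f k s)>> \subset fst_morphism A K @* <<marks M'>>.
    rewrite gen_subG; apply/fintype.subsetP => _ /imsetP[j _ ->] /=.
    have jk : (val j < k2)%N by apply: leq_trans (ltn_ord j) (leq_addr _ _).
    apply/morphimP; exists (f2 (s2 (val j))); first by rewrite finset.in_setT.
      exact: mM'.
    by rewrite -fs2.
  move=> /fintype.subsetP sub /sub /morphimP[b _ bM fxb].
  have : b \in hom_image f2.
    have : <<marks M'>> \subset Group (hom_image_group hf2).
      rewrite gen_subG; apply/fintype.subsetP => _ /imsetP[j _ ->] /=.
      by apply/hom_imageP; exists (s2 (val j)).
    by move=> /fintype.subsetP; exact.
  move=> /hom_imageP[l Ll bl].
  have LlV := subgroupV gL Ll; have Llx := subgroupM gL LlV Lx.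
  pose c := h (l^-1 * x).
  have flx : f (l^-1 * x) = 1.
    by rewrite (hom_onM hf)// (hom_onV gL hf)// fxb -bl mulVg.
  have [Lr fr /(_ _)] := rP c; move=> hr.
  have {}hr : h (r c) = c by apply: hr; exists (l^-1 * x).
  have -> : f2 x = b * f2 (r c).
    rewrite -bl -[in LHS](mulKVg l x) (hom_onM hf2)//; congr (_ * _).
    by rewrite /f2 flx fr hr.
  rewrite groupM//.
  have jc : (k + index c (enum K) < k2)%N.
    by rewrite ltn_add2l cardE index_mem mem_enum.
  suff -> : r c = s2 (k + index c (enum K))%N by exact: mM'.
  by rewrite /s2 ltnNge leq_addr /= jc addKn nth_index// mem_enum.
- by move=> x Lx [].
- exact: leq_addr.
- by move=> x Lx [].
Qed.

Lemma marking_step M (K : finGroupType) (h : F -> K) (K' : finGroupType)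
    (a : nat -> K') m : marking_ok M -> hom_on L h ->
  (forall j, (m <= j)%N -> a j = 1) ->
  exists M', [/\ marking_ok M', marking_ext M M', finer (mk_f M') h &
    exists g : F -> K', [/\ hom_on L g, finer (mk_f M') g &
      forall j, g (mk_s M' j) = a j]].
Proof.
move=> okM hh a1.
have [M1 [g [ok1 [e1f e1k e1s] hg fg ga]]] := marking_forth okM a1.
have [M2 [ok2 [e2f e2k e2s] fh]] := marking_back ok1 hh.
have [hf Ls _ _] := okM; have [hf1 Ls1 _ _] := ok1; have [hf2 Ls2 _ _] := ok2.
have f2g : finer (mk_f M2) g by move=> x Lx /(e2f x Lx)/(fg x Lx).
exists M2; split => //.
  split; first by move=> x Lx /(e2f x Lx)/(e1f x Lx).
    exact: leq_trans e1k e2k.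
  by move=> j; rewrite -e1s; apply: (finer_eq hf1 hf e1f).
exists g; split => // j; rewrite -ga.
exact: (finer_eq hf1 hg fg).
Qed.


Lemma hom_fiber_closed (K : finGroupType) (f : F -> K) c : hom_on L f ->
  closed [set x | L x /\ f x = c].
Proof.
move=> hf; have [_ [N [oN fN]]] := hf => x cx.
have Lx : L x by apply: cL => O /cx[z [[Lz _] Oz]]; exists z.
have : nbhs x [set z | N (x^-1 * z)].
  apply: open_nbhs_nbhs; split; first exact: (open_mulgl _ oN.2).
  by rewrite /= mulVg; exact: (subgroup1 oN.1).
move=> /cx[z [[Lz fz] Nz]]; split => //.
have LxV := subgroupV gL Lx.
have := fN _ (subgroupM gL LxV Lz) Nz.
rewrite (hom_onM hf)// (hom_onV gL hf)// fz => /(canRL (mulKg _)).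
by rewrite invgK mulg1.
Qed.

(** The properties of a basis converging to 1, read in [F]. *)
Definition converging_basis (y : nat -> F) :=
  [/\ forall j, L (y j),
      forall N, open_subgroup N -> exists k, forall j, (k <= j)%N -> N (y j),
      forall N, open_subgroup N -> (forall j, N (y j)) -> L `<=` N &
      forall (K : finGroupType) (a : nat -> K) m,
        (forall j, (m <= j)%N -> a j = 1) ->
        exists g, hom_on L g /\ forall j, g (y j) = a j].

(** Iterate the two refinements over all prescriptions of values in ['S_n] and all
    members of a cofinal sequence of quotients. The sequences so obtained are
    compatible modulo smaller and smaller subgroups, so they have a limit by
    compactness. *)
Lemma iwasawa (d : nat -> nat) (h : forall m, F -> {perm 'I_(d m)}) :
  (forall m, hom_on L (h m)) ->
  (forall W, open_subgroup W -> exists m, forall x, L x -> h m x = 1 -> W x) ->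
  exists y, converging_basis y.
Proof.
move=> hh cof.
pose T : countType := {n : nat & seq {perm 'I_n}}.
pose t0 : T := Tagged (fun n => seq {perm 'I_n}) ([::] : seq {perm 'I_0}).
pose t m : T := odflt t0 (choice.unpickle m).
pose S := {M | marking_ok M}.
pose unitM := @Marking {perm 'I_0} (fun=> 1) 0 (fun=> 1).
have unit_ok : marking_ok unitM.
  split => //=.
  - split=> [x z _ _|]; first by rewrite mulg1.
    by exists setT; split=> //; exact: open_subgroupT.
  - by move=> j; exact: (subgroup1 gL).
pose spec m (M M' : marking) := [/\ marking_ext M M', finer (mk_f M') (h m) &
  exists g : F -> {perm 'I_(tag (t m))}, [/\ hom_on L g, finer (mk_f M') g &
    forall j, g (mk_s M' j) = nth 1 (tagged (t m)) j]].
have stepP (p : nat * S) : exists M' : S, spec p.1 (sval p.2) (sval M').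
  case: p => m [M okM] /=.
  have [|M' [okM' ext fh fg]] := marking_step (a := nth 1 (tagged (t m)))
     (m := size (tagged (t m))) okM (hh m).
    by move=> j; exact: nth_default.
  by exists (exist _ M' okM').
have [nxt nxtP] := choice stepP.
pose st := fix st m : S :=
  if m is k.+1 then nxt (k, st k) else exist _ unitM unit_ok.
pose f m := mk_f (sval (st m)); pose s m := mk_s (sval (st m)).
have ok m : marking_ok (sval (st m)) by exact: (svalP (st m)).
have hf m : hom_on L (f m) by case: (ok m).
have Ls m j : L (s m j) by case: (ok m) => _ + _ _; apply.
have next m : spec m (sval (st m)) (sval (st m.+1)) := nxtP (m, st m).
have fin m : finer (f m.+1) (f m) by case: (next m) => -[].
have fs m j : f m (s m.+1 j) = f m (s m j).
  by case: (next m) => -[_ _ + _ _]; apply.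
have : forall j, exists x, forall m, L x /\ f m x = f m (s m j).
  move=> j; have [Fc _ _] := Fpro.
  apply: (@compact_nested F (fun m => [set x | L x /\ f m x = f m (s m j)])) => //.
  - by move=> m; exact: hom_fiber_closed.
  - by move=> m; exists (s m j).
  - move=> m x [Lx fx]; split => //.
    by rewrite -fs; apply: (finer_eq (hf m.+1) (hf m)).
move=> /choice[y yP].
have Ly j : L (y j) by case: (yP j 0%N).
have fy j m : f m (y j) = f m (s m j) by case: (yP j m).
have fine W : open_subgroup W -> exists m, forall x, L x -> f m x = 1 -> W x.
  move=> /cof[m hW]; exists m.+1 => x Lx fx; apply: hW => //.
  by case: (next m) => _ + _; apply.
have gen N : open_subgroup N -> (forall j, N (y j)) -> L `<=` N.
  move=> oN Ny x Lx; have [m fN] := fine N oN.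
  have [_ _ _ /(_ x Lx)] := ok m.
  pose LN : set F := L `&` N.
  have gLN : is_subgroup LN by apply: subgroupI => //; case: oN.
  have hLN : hom_on LN (f m) by apply: (hom_onS _ (hf m)) => z [].
  pose HN : {set mk_K (sval (st m))} :=
    [set a | `[< exists2 z, LN z & f m z = a >]]%SET.
  have HNP a : reflect (exists2 z, LN z & f m z = a) (a \in HN).
    by rewrite inE; exact: asboolP.
  have gHN : group_set HN.
    apply/group_setP; split.
      apply/HNP; exists 1; first exact: (subgroup1 gLN).
      exact: (hom_on1 gLN hLN).
    move=> a b /HNP[u Lu <-] /HNP[v Lv <-].
    apply/HNP; exists (u * v); first exact: (subgroupM gLN).
    exact: (hom_onM hLN).
  have sub : <<marks (sval (st m))>> \subset Group gHN.
    rewrite gen_subG; apply/fintype.subsetP => _ /imsetP[j _ ->].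
    by apply/HNP; exists (y (val j)); [split|exact: fy].
  move=> /(fintype.subsetP sub)/HNP[z [Lz Nz] fz].
  have LzV := subgroupV gL Lz.
  have NzV : N (z^-1 * x).
    apply: fN; first exact: (subgroupM gL).
    by rewrite (hom_onM (hf m))// (hom_onV gL (hf m))// fz mulVg.
  by have := subgroupM oN.1 Nz NzV; rewrite mulKVg.
exists y; split => //.
- move=> N /fine[m fN]; exists (mk_k (sval (st m))) => j kj.
  apply: fN => //; rewrite fy /s; have [_ _ -> // _] := ok m.
  exact: (hom_on1 gL (hf m)).
- move=> K a m0 a1; have [n [e [e_inj eM]]] := cayley K.
  pose tt : T := Tagged (fun n => seq {perm 'I_n}) (mkseq (e \o a) m0).
  pose m := choice.pickle tt.
  have e1 : e 1 = 1 by apply: (mulgI (e 1)); rewrite -eM mulg1 [RHS]mulg1.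
  have [g [hg gy]] : exists g : F -> {perm 'I_n}, hom_on L g /\
      forall j, g (y j) = e (a j).
    have := next m => -[_ _]; have -> : t m = tt by rewrite /t choice.pickleK.
    move=> [g [hg fg gs]]; exists g; split => // j.
    rewrite (_ : g (y j) = g (s m.+1 j)); last first.
      exact: (finer_eq (hf m.+1) hg fg).
    rewrite gs /=; case: (ltnP j m0) => jm; first by rewrite nth_mkseq.
    by rewrite nth_default ?size_mkseq// a1.
  have eG : group_set (e @: finset.setT)%SET.
    apply/group_setP; split; first by apply/imsetP; exists 1.
    move=> _ _ /imsetP[u _ ->] /imsetP[v _ ->].
    by rewrite -eM; apply/imsetP; exists (u * v).
  have [U [g' [oU LU hg' g'E _]]] := hom_extension Fpro gL hg.
  have gE x : L x -> g x \in (e @: finset.setT)%SET.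
    move=> Lx; rewrite -g'E//.
    have [|_ /=] := gen _ (hom_on_preim (Group eG) oU hg') _ x Lx; last exact.
    move=> j; split; first exact: LU.
    by rewrite /= g'E// gy; apply/imsetP; exists (a j).
  pose p u := odflt 1 [pick k | e k == u].
  have eK k : p (e k) = k.
    by rewrite /p; case: pickP => [k' /eqP/e_inj//|/(_ k)]; rewrite eqxx.
  exists (p \o g); split; last by move=> j /=; rewrite gy eK.
  apply: (hom_on_comp gL hg gE).
  by move=> _ _ /imsetP[u _ ->] /imsetP[v _ ->]; rewrite -eM !eK.
Qed.

End Iwasawa.

(** * The closed subgroup as a profinite group *)

Section Transfer.
Variable F : topologicalGroupType.
Hypothesis Fpro : profinite F.
Variable L : subgroup F.
Hypothesis cL : closed (L : set F).

Local Notation sL := (set_type L).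

Let gL : is_subgroup (L : set F) := subgroupP L.
Let Lval (x : sL) : (L : set F) (set_val x). Proof. exact: set_valP. Qed.

Lemma subgroup_nbhs (x : sL) (B : set sL) : nbhs x B ->
  exists N, [/\ open_subgroup N, forall g z, N z -> N (g * z * g^-1) &
    forall z : sL, N ((set_val x)^-1 * set_val z) -> B z].
Proof.
rewrite nbhsE => -[_ [[O oO <-] /= Ox] OB].
have [|W [oW WO]] := open_subgroup_basis Fpro (open_mulgl (set_val x) oO).
  by rewrite /= mulg1.
have [N [oN NW nN]] := open_normal_core Fpro oW.
by exists N; split => // z /NW/WO /=; rewrite mulKVg => /OB.
Qed.

Lemma subgroup_coset_nbhs (x : sL) N : open_subgroup N ->
  nbhs x [set z : sL | N ((set_val x)^-1 * set_val z)].
Proof.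
move=> oN; apply: open_nbhs_nbhs; split; last first.
  by rewrite /= mulVg; exact: (subgroup1 oN.1).
by exists [set z | N ((set_val x)^-1 * z)] => //; exact: (open_mulgl _ oN.2).
Qed.

Lemma subgroup_compact : compact [set: sL].
Proof.
move=> G PG _; have [Fc _ _] := Fpro.
have [p [_ Gp]] := Fc (set_val @ G) _ filterT.
have Lp : (L : set F) p.
  apply: cL => O Op.
  have [|z [Lz Oz]] := Gp (L : set F) O _ Op; last by exists z.
  by rewrite /fmap /=; apply: filterS filterT => z _ /=.
exists (exist _ p (mem_set Lp)); split => // A B GA.
move=> /subgroup_nbhs[N [oN _ NB]].
have [||_ [[z Az <-] Nz]] := Gp (set_val @` A) [set z | N (p^-1 * z)].
- by rewrite /fmap /=; apply: filterS GA => z Az; exists z.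
- apply: open_nbhs_nbhs; split; first exact: (open_mulgl _ oN.2).
  by rewrite /= mulVg; exact: (subgroup1 oN.1).
by exists z; split => //; exact: NB.
Qed.

Lemma subgroup_zero_dimensional : zero_dimensional sL.
Proof.
move=> x z /eqP xz.
have xz1 : (set_val x)^-1 * set_val z <> 1.
  move=> e; apply: xz; apply: val_inj; have := congr1 (mulg (set_val x)) e.
  by rewrite mulKVg mulg1 => /esym.
have [N [oN nN nNxz]] := open_normal_separation Fpro xz1.
exists [set u : sL | N ((set_val x)^-1 * set_val u)]; split => //; last first.
  by rewrite /= mulVg; exact: (subgroup1 oN.1).
split.
  by exists [set u | N ((set_val x)^-1 * u)] => //; exact: (open_mulgl _ oN.2).
rewrite -openC; exists [set u | ~ N ((set_val x)^-1 * u)] => //.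
apply: (@open_mulgl _ (~` N)); apply: closed_openC.
exact: open_subgroup_closed.
Qed.

Lemma zero_dimensional_hausdorff (T : topologicalType) :
  zero_dimensional T -> hausdorff_space T.
Proof.
move=> zT p q pq; apply: contrapT => /eqP /zT[U [[oU cU] Up nUq]].
have [] := pq U (~` U).
- exact: open_nbhs_nbhs.
- by apply: open_nbhs_nbhs; split => //; exact: closed_openC.
- by move=> z [].
Qed.

Lemma subgroup_profinite : profinite sL.
Proof.
have z := subgroup_zero_dimensional.
split; [exact: subgroup_compact|exact: zero_dimensional_hausdorff|].
exact: zero_dimension_totally_disconnected.
Qed.

(** Distinct indices are separated by a homomorphism to a group of order 2. *)
Lemma converging_basis_injective y : converging_basis L y -> injective y.
Proof.
move=> [_ _ _ univ] i j yij; apply: contrapT => /eqP ij.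
pose a k : {perm bool} := if k == i then tperm true false else 1.
have [|g [_ ga]] := univ _ a (maxn i j).+1.
  move=> k; rewrite gtn_max /a => /andP[ik _].
  by rewrite gtn_eqF.
have := ga i; rewrite yij ga /a eqxx eq_sym (negbTE ij).
by move=> /(congr1 (fun p : {perm bool} => p true)); rewrite tpermL perm1.
Qed.

Lemma abstract_gen_subgroup (G : groupType) (X : set G) :
  is_subgroup (abstract_gen X).
Proof. by apply: subgroup_bigcap => A []. Qed.

Lemma subgroup_image_val (A : set sL) : is_subgroup A ->
  is_subgroup (set_val @` A).
Proof.
move=> gA; apply/is_subgroupP; split.
- by exists 1; [exact: subgroup1|].
- by move=> _ _ [u Au <-] [v Av <-]; exists (u * v); [exact: subgroupM|].
- by move=> _ [u Au <-]; exists u^-1; [exact: subgroupV|].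
Qed.

Lemma converging_basis_free y : converging_basis L y ->
  free_profinite_of_rank sL [set: nat].
Proof.
move=> yb; have y_inj := converging_basis_injective yb.
have [Ly y1 gen univ] := yb.
split; first exact: subgroup_profinite.
pose z j : sL := exist _ (y j) (mem_set (Ly j)).
have z_inj : injective z by move=> i j /(congr1 set_val) /y_inj.
exists (range z); split; last first.
  exact: inj_card_eq (in2W z_inj).
split.
- move=> O [x Ox] oO.
  have [N [oN nN NO]] := subgroup_nbhs (open_nbhs_nbhs (conj oO Ox)).
  pose A := abstract_gen (range z).
  have gA : is_subgroup (set_val @` A).
    exact: (subgroup_image_val (abstract_gen_subgroup _)).
  have oW := open_subgroup_mul gA oN nN.
  have [|_ [a Aa <-] Na] := gen _ oW _ _ (Lval x).
    move=> j; exists (y j); last by rewrite mulVg; exact: (subgroup1 oN.1).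
    by exists (z j) => // B [_]; apply; exists j.
  exists a; split => //; apply: NO.
  by have := subgroupV oN.1 Na; rewrite invgM invgK.
- move=> U gU oU.
  have [N [oN nN NU]] := subgroup_nbhs (open_nbhs_nbhs (conj oU (subgroup1 gU))).
  have [k kN] := y1 N oN.
  apply: (sub_finite_set _ (finite_image z (finite_II k))).
  move=> _ [[j _ <-] nUj]; exists j => //=; rewrite ltnNge; apply/negP => kj.
  apply: nUj; apply: NU; rewrite invg1 mul1g; exact: kN.
- move=> K a fa.
  have : finite_set [set j | a (z j) <> 1].
    apply: (sub_finite_set _ (finite_preimage (f := z) (in2W z_inj) fa)) => j aj.
    by split => //; exists j.
  move=> /finite_seqP[s sE].
  have [|g [hg ga]] := univ K (a \o z) (\max_(j <- s) j).+1.
    move=> j js; apply: contrapT => aj.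
    have : [set j | a (z j) <> 1] j by [].
    rewrite sE /= => /(@leq_bigmax_seq _ _ xpredT id) => /(_ isT).
    by rewrite leqNgt js.
  exists (g \o set_val); split; last by move=> _ [j _ <-] /=; exact: ga.
  split; first by move=> u v; rewrite /= -(hom_onM hg).
  have [_ [N [oN gN]]] := hg.
  move=> u B /nbhs_singleton Bgu; apply: filterS (subgroup_coset_nbhs u oN).
  move=> v /= Nuv; suff <- : g (set_val u) = g (set_val v) by [].
  have LuV := subgroupV gL (Lval u).
  have := gN _ (subgroupM gL LuV (Lval v)) Nuv.
  rewrite (hom_onM hg)// (hom_onV gL hg)// => /(canRL (mulKg _)).
  by rewrite invgK mulg1.
Qed.

End Transfer.

(** * Free subgroups of infinite rank above a closed subgroup *)

Lemma infinite_index_not_open (F : topologicalGroupType) (H : set F) :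
  profinite F -> is_subgroup H -> infinite_index H -> ~ open H.
Proof.
move=> Fpro gH infH oH; apply: infH.
have [n [cl clP]] := finite_right_cosets Fpro (conj gH oH).
pose f (c : 'I_n) : set F := [set z | cl z^-1 = c].
apply: (sub_finite_set _ (finite_image f (@finite_finset _ setT))).
move=> _ [g _ <-]; exists (cl g^-1) => //; apply/seteqP; split => z.
  move=> /clP; rewrite invgK => Hzg; exists (g^-1 * z); last by rewrite mulKVg.
  by have := subgroupV gH Hzg; rewrite invgM invgK.
move=> [h Hh <-]; apply/clP; rewrite invgM invgK mulgKV.
exact: (subgroupV gH).
Qed.

Theorem theorem1p3 (F : topologicalGroupType) (H : subgroup F)
  (F_free : free_profinite F)
  (F_nonabelian : nonabelian F)
  (F_fg : finitely_generated F)
  (H_closed : closed (H : set F))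
  (H_index : infinite_index (H : set F)) :
  exists L : subgroup F,
    [/\ closed (L : set F),
        (H : set F) `<=` (L : set F) &
        free_profinite_of_rank (set_type L) [set: nat]].
Proof.
have [Fpro [X Xb]] := F_free.
have [n [y yb]] := finite_free_basis F_fg Xb.
have I1 := nonabelian_free_basis Fpro F_nonabelian yb.
have nH : closed_nonopen H.
  split; [exact: subgroupP|exact: H_closed|].
  by apply: infinite_index_not_open => //; exact: subgroupP.
have [L [gL cL HL rL]] := rich_exists Fpro yb I1 nH.
exists (Subgroup gL); split => //.
have [d [h [hh cof]]] := cofinal_homs Fpro yb.
have [z zb] := iwasawa Fpro gL cL
  (fun K K' B p f pM => @rich_embedding F Fpro K K' B p pM L f gL rL)
  (fun m => hom_onS (@subsetT _ L) (hh m))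
  (fun W oW => let: ex_intro m hW := cof W oW in
     ex_intro _ m (fun x _ => hW x)).
exact: (converging_basis_free (L := Subgroup gL) Fpro cL zb).
Qed.
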